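(* Let $(\alpha,\beta)$ be a rigid variable elliptic structure on an open set $\Omega\subset\mathbb{R}^2$ with spectral parameter $\lambda$, let $\xi(x,y)=y-\lambda(x,y)\,x$ and $\Phi=\bar\xi_x+\lambda\,\bar\xi_y$. Let $\Omega'\subseteq\Omega$ be an open set on which $\Phi\neq0$ and $\xi$ is injective. Then $\xi$ establishes a ring isomorphism between the ring of rigid holomorphic functions on $\Omega'$ and the ring of holomorphic functions on $\xi(\Omega')\subset\mathbb{C}$; namely, $g\mapsto g\circ\xi$ is a ring isomorphism from the holomorphic functions on $\xi(\Omega')$ onto the rigid holomorphic functions on $\Omega'$.
   Context: A variable elliptic structure on an open set $\Omega\subset\mathbb{R}^2$ (coordinates $(x,y)$) is a pair $\alpha,\beta\in C^1(\Omega,\mathbb{R})$ with $\Delta:=4\alpha-\beta^2>0$. Its spectral parameter is $\lambda=\frac{-\beta+\mathrm{i}\sqrt{\Delta}}{2}$ ($\mathrm{i}$ the imaginary unit), a $C^1$ function with $\operatorname{Im}\lambda>0$. The structure is rigid if $\lambda_x+\lambda\lambda_y=0$ on $\Omega$ (equivalently, the generator $i$ of the fiber algebras $\mathbb{R}[X]/(X^2+\beta X+\alpha)$ satisfies $i_x+i\,i_y=0$). A rigid holomorphic function on $\Omega'$ is a $C^1$ function $f:\Omega'\to\mathbb{C}$ with $f_x+\lambda f_y=0$; ring operations are pointwise. *)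

(* Defs.v *)
From HB Require Import structures.
From mathcomp Require Import all_boot all_order all_algebra.
From mathcomp Require Import all_classical all_reals all_analysis.
From mathcomp Require Import complex.
From mathcomp Require Import ring.

Set Implicit Arguments.
Unset Strict Implicit.
Unset Printing Implicit Defensive.

Import Order.TTheory GRing.Theory Num.Theory.
Import numFieldNormedType.Exports.

Local Open Scope classical_set_scope.
Local Open Scope ring_scope.
Local Open Scope complex_scope.

Section Structures.
Context {R : realType}.
Implicit Types (U : set (R * R)) (a b u : R * R -> R) (lam f : R * R -> R[i]).

(* Continuously Frechet differentiable, for U open: in finite dimension,
   continuity of p |-> 'd u p is continuity of p |-> 'd u p v for every v. *)
Definition C1 U u : Prop :=
  (forall p, U p -> differentiable u p) /\
  (forall v p, U p -> {for p, continuous ('D_v u)}).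

Definition C1_complex U f : Prop :=
  C1 U (fun p => complex.Re (f p)) /\ C1 U (fun p => complex.Im (f p)).

Definition derive_complex (v : R * R) f (p : R * R) : R[i] :=
  'D_v (fun q => complex.Re (f q)) p +i* 'D_v (fun q => complex.Im (f q)) p.

Definition dx f : R * R -> R[i] := derive_complex (1, 0) f.
Definition dy f : R * R -> R[i] := derive_complex (0, 1) f.

Definition Delta a b (p : R * R) : R := 4 * a p - b p ^+ 2.

Definition elliptic_structure U a b : Prop :=
  [/\ C1 U a, C1 U b & forall p, U p -> 0 < Delta a b p].

Definition spectral a b (p : R * R) : R[i] :=
  ((- b p) +i* Num.sqrt (Delta a b p)) / 2.

Definition rigid U a b : Prop :=
  let lam := spectral a b in
  forall p, U p -> dx lam p + lam p * dy lam p = 0.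

Definition xi lam (p : R * R) : R[i] := (p.2)%:C - lam p * (p.1)%:C.

Definition Phi lam (p : R * R) : R[i] :=
  let xibar q := (xi lam q)^* in dx xibar p + lam p * dy xibar p.

(* Functions on an open set are functions on the corresponding subtype;
   derivatives are those of the extension by zero (valL_ 0), which at a point
   of an open set depend only on the function itself. *)
Definition rigid_holomorphic lam U (hU : open U) : {pred U -> R[i]} :=
  fun h => let f := valL_ 0 h in
  `[< C1_complex U f /\ forall p, U p -> dx f p + lam p * dy f p = 0 >].

(* R[i]^o is R[i] as a normed module over itself: derivability in the
   direction 1 is complex differentiability.  hV (like hU above) is only used
   to prove that these functions form a subring. *)
Definition holomorphic (V : set R[i]^o) (hV : open V) : {pred V -> R[i]} :=
  fun g => `[< forall z, V z -> derivable (valL_ 0 g : R[i]^o -> R[i]^o) z 1 >].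

Definition image_val (S T : Type) (F : S -> T) (A : set S) (p : A) : F @` A :=
  exist _ (F (val p)) (mem_set (imageP F (set_mem (valP p)))).

End Structures.

Section Subring.
Context {R : realType}.

Section Extension.
Context {T : Type} {K : pzRingType} (A : set T).
Implicit Types f g : A -> K.

Lemma valL0E f x (Ax : x \in A) : valL_ 0 f x = f (exist _ x Ax).
Proof. by rewrite /valL_ oinv_set_val /= insubT. Qed.

Lemma valL0_out f x : x \notin A -> valL_ 0 f x = 0.
Proof. by move=> nA; rewrite /valL_ oinv_set_val /= insubN. Qed.

Lemma valL0B f g : valL_ 0 (f - g) = valL_ 0 f - valL_ 0 g.
Proof.
apply/funext => x; rewrite !fctE; have [Ax|nA] := boolP (x \in A).
  by rewrite !valL0E.
by rewrite !valL0_out // subr0.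
Qed.

Lemma valL0M f g : valL_ 0 (f * g) = valL_ 0 f * valL_ 0 g.
Proof.
apply/funext => x; rewrite !fctE; have [Ax|nA] := boolP (x \in A).
  by rewrite !valL0E.
by rewrite !valL0_out // mul0r.
Qed.

Lemma valL0_1 x : A x -> valL_ 0 (1 : A -> K) x = 1.
Proof. by move=> /mem_set Ax; rewrite valL0E. Qed.

End Extension.

Lemma near_eq_differentiable (K : numFieldType) (V W : normedModType K)
    (f g : V -> W) (x : V) :
  {near x, g =1 f} -> differentiable g x -> differentiable f x.
Proof.
move=> fg /diff_locallyP[dgc dg].
have fgx : g x = f x := nbhs_singleton fg.
have df : f \o shift x = cst (f x) + 'd g x +o_ 0 id.
  apply/eqaddoP => e e0; move/eqaddoP: dg => /(_ e e0).
  have : \forall y \near x, g y = f y by [].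
  rewrite (near_shift 0 x); apply: filterS2 => h /=.
  by rewrite !fctE /= subr0 fgx => ->.
have E := diff_unique dgc df.
by apply/diff_locallyP; rewrite E.
Qed.

Section C1.
Variable (U : set (R * R)) (hU : open U).
Implicit Types u w : R * R -> R.

Lemma C1_near_cst u c : (forall p, U p -> u p = c) -> C1 U u.
Proof.
move=> uc.
have un p : U p -> {near p, cst c =1 u}.
  move=> Up; have : nbhs p U by exact: open_nbhs_nbhs.
  by apply: filterS => q Uq; rewrite uc.
split=> [p Up|v p Up].
  exact: (near_eq_differentiable (un p Up)).
have D0 q : U q -> 'D_v u q = 0.
  move=> Uq; rewrite -(near_eq_derive _ (un q Uq)).
  by rewrite derive_cst.
rewrite /prop_for /continuous_at D0 //.
apply: cvg_near_cst.
have : nbhs p U by exact: open_nbhs_nbhs.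
by apply: filterS => q; exact: D0.
Qed.

Lemma C1B u w : C1 U u -> C1 U w -> C1 U (fun p => u p - w p).
Proof.
move=> [du cu] [dw cw]; split=> [p Up|v p Up].
  exact: (differentiableB (du _ Up) (dw _ Up)).
have E q : U q -> 'D_v (fun p => u p - w p) q = 'D_v u q - 'D_v w q.
  by move=> Uq; apply: deriveB; apply: diff_derivable; [exact: du|exact: dw].
rewrite /prop_for /continuous_at E //.
have H : 'D_v u q - 'D_v w q @[q --> p] --> 'D_v u p - 'D_v w p.
  by apply: cvgB; [exact: cu|exact: cw].
apply: cvg_trans H; apply: near_eq_cvg.
have : nbhs p U by exact: open_nbhs_nbhs.
by apply: filterS => q Uq; rewrite E.
Qed.

Lemma deriveM_C1 u w v q : C1 U u -> C1 U w -> U q ->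
  'D_v (fun p => u p * w p) q = u q * 'D_v w q + w q * 'D_v u q.
Proof.
move=> [du _] [dw _] Uq.
by apply: deriveM; apply: diff_derivable; [exact: du|exact: dw].
Qed.

Lemma C1M u w : C1 U u -> C1 U w -> C1 U (fun p => u p * w p).
Proof.
move=> Cu Cw; have [du cu] := Cu; have [dw cw] := Cw; split=> [p Up|v p Up].
  exact: (differentiableM (du _ Up) (dw _ Up)).
rewrite /prop_for /continuous_at (deriveM_C1 v Cu Cw) //.
have H : u q * 'D_v w q + w q * 'D_v u q @[q --> p] -->
     u p * 'D_v w p + w p * 'D_v u p.
  have uc := differentiable_continuous (du _ Up).
  have wc := differentiable_continuous (dw _ Up).
  apply: cvgD; apply: cvgM => //; [exact: cw|exact: cu].
apply: cvg_trans H; apply: near_eq_cvg.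
have : nbhs p U by exact: open_nbhs_nbhs.
by apply: filterS => q Uq; rewrite (deriveM_C1 v Cu Cw).
Qed.

End C1.

Section Rigid.
Variables (lam : R * R -> R[i]) (U : set (R * R)) (hU : open U).
Implicit Types f g : R * R -> R[i].

Lemma derive_complexB v f g p : C1_complex U f -> C1_complex U g -> U p ->
  derive_complex v (f - g) p = derive_complex v f p - derive_complex v g p.
Proof.
move=> [[fr _] [fi _]] [[gr _] [gi _]] Up; rewrite /derive_complex.
have -> : (fun q => complex.Re ((f - g) q)) =
    (fun q => complex.Re (f q)) - (fun q => complex.Re (g q)).
  by apply/funext => q; rewrite !fctE raddfB.
have -> : (fun q => complex.Im ((f - g) q)) =
    (fun q => complex.Im (f q)) - (fun q => complex.Im (g q)).
  by apply/funext => q; rewrite !fctE raddfB.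
rewrite !deriveB //; apply: diff_derivable;
  by [exact: fr|exact: fi|exact: gr|exact: gi].
Qed.

Lemma C1_complexB f g :
  C1_complex U f -> C1_complex U g -> C1_complex U (f - g).
Proof.
move=> [fr fi] [gr gi]; split.
  rewrite (_ : (fun _ => _) = fun p => complex.Re (f p) - complex.Re (g p)).
    exact: C1B.
  by apply/funext => q; rewrite fctE raddfB.
rewrite (_ : (fun _ => _) = fun p => complex.Im (f p) - complex.Im (g p)).
  exact: C1B.
by apply/funext => q; rewrite fctE raddfB.
Qed.

Let ReM f g : (fun q => complex.Re ((f * g) q)) =
  fun q => complex.Re (f q) * complex.Re (g q) -
           complex.Im (f q) * complex.Im (g q).
Proof. by apply/funext => q; rewrite fctE; case: (f q) (g q) => [? ?] []. Qed.

Let ImM f g : (fun q => complex.Im ((f * g) q)) =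
  fun q => complex.Re (f q) * complex.Im (g q) +
           complex.Im (f q) * complex.Re (g q).
Proof. by apply/funext => q; rewrite fctE; case: (f q) (g q) => [? ?] []. Qed.

Lemma C1_complexM f g :
  C1_complex U f -> C1_complex U g -> C1_complex U (f * g).
Proof.
move=> [fr fi] [gr gi]; split; rewrite ?ReM ?ImM.
  exact: (C1B hU (C1M hU fr gr) (C1M hU fi gi)).
have -> : (fun q => complex.Re (f q) * complex.Im (g q) +
     complex.Im (f q) * complex.Re (g q)) =
   (fun q => complex.Re (f q) * complex.Im (g q) -
     (0 - complex.Im (f q) * complex.Re (g q))).
  by apply/funext => q; rewrite sub0r opprK.
have C0 : C1 U (fun _ => 0) by exact: (@C1_near_cst _ hU _ 0).
exact: (C1B hU (C1M hU fr gi) (C1B hU C0 (C1M hU fi gr))).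
Qed.

Lemma derive_complexM v f g p : C1_complex U f -> C1_complex U g -> U p ->
  derive_complex v (f * g) p =
  f p * derive_complex v g p + g p * derive_complex v f p.
Proof.
move=> [fr fi] [gr gi] Up; rewrite /derive_complex ReM ImM.
have d u : C1 U u -> derivable u p v.
  by move=> [du _]; apply: diff_derivable; exact: du.
have -> : 'D_v (fun q => complex.Re (f q) * complex.Re (g q) -
           complex.Im (f q) * complex.Im (g q)) p =
  'D_v (fun q => complex.Re (f q) * complex.Re (g q)) p -
  'D_v (fun q => complex.Im (f q) * complex.Im (g q)) p.
  by apply: deriveB; apply: d; exact: C1M.
have -> : 'D_v (fun q => complex.Re (f q) * complex.Im (g q) +
           complex.Im (f q) * complex.Re (g q)) p =
  'D_v (fun q => complex.Re (f q) * complex.Im (g q)) p +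
  'D_v (fun q => complex.Im (f q) * complex.Re (g q)) p.
  by apply: deriveD; apply: d; exact: C1M.
rewrite (deriveM_C1 v fr gr) // (deriveM_C1 v fi gi) //.
rewrite (deriveM_C1 v fr gi) // (deriveM_C1 v fi gr) //.
case: (f p) (g p) => [fa fb] [ga gb] /=.
by simpc; congr (_ +i* _); ring.
Qed.

Lemma rigid_holomorphic_subring :
  subring_closed (rigid_holomorphic lam hU).
Proof.
split.
- apply/asboolP; split.
    split.
      by apply: (@C1_near_cst _ hU _ 1) => p Up; rewrite valL0_1.
    by apply: (@C1_near_cst _ hU _ 0) => p Up; rewrite valL0_1.
  move=> p Up; have d0 v : derive_complex v (valL_ 0 (1 : U -> R[i])) p = 0.
    have n : nbhs p U by exact: open_nbhs_nbhs.
    have dc (u : R * R -> R) c : (forall q, U q -> u q = c) -> 'D_v u p = 0.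
      move=> uc; rewrite -(derive_cst c p v); apply: near_eq_derive.
      by apply: filterS n => q Uq; rewrite uc.
    by rewrite /derive_complex (dc _ 1) ?(dc _ 0) // => q Uq; rewrite valL0_1.
  by rewrite /dx /dy !d0 mulr0 addr0.
- move=> f g /asboolP[Cf ef] /asboolP[Cg eg]; apply/asboolP; rewrite valL0B.
  split=> [|p Up]; first exact: C1_complexB.
  rewrite /dx /dy !(derive_complexB _ Cf Cg Up).
  move: (ef p Up) (eg p Up); rewrite /dx /dy.
  move: (derive_complex _ _ _) (derive_complex _ _ _) => x y.
  move: (derive_complex _ _ _) (derive_complex _ _ _) => z w Ef Eg.
  by rewrite mulrBr addrACA -opprD Ef Eg subrr.
- move=> f g /asboolP[Cf ef] /asboolP[Cg eg]; apply/asboolP; rewrite valL0M.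
  split=> [|p Up]; first exact: C1_complexM.
  rewrite /dx /dy !(derive_complexM _ Cf Cg Up).
  move: (ef p Up) (eg p Up); rewrite /dx /dy.
  move: (derive_complex _ _ _) (derive_complex _ _ _) => x y.
  move: (derive_complex _ _ _) (derive_complex _ _ _) => z w Ef Eg.
  move: (valL_ 0 f p) (valL_ 0 g p) => F G.
  transitivity (F * (w + lam p * z) + G * (y + lam p * x)); first by ring.
  by rewrite Ef Eg !mulr0 addr0.
Qed.

HB.instance Definition _ := GRing.isSubringClosed.Build (U -> R[i])
  (rigid_holomorphic lam hU) rigid_holomorphic_subring.

Record rigid_holomorphic_ring := RigidHolomorphic {
  rigid_val :> U -> R[i];
  rigid_valP : rigid_val \in rigid_holomorphic lam hU }.

HB.instance Definition _ := [isSub for rigid_val].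
HB.instance Definition _ := [Choice of rigid_holomorphic_ring by <:].
HB.instance Definition _ :=
  GRing.SubChoice_isSubComPzRing.Build _ _ rigid_holomorphic_ring
    (subringClosedP _).

End Rigid.

Section Holomorphic.
Variables (V : set R[i]^o) (hV : open V).

Lemma holomorphic_subring : subring_closed (holomorphic hV).
Proof.
split.
- apply/asboolP => z Vz.
  apply: (@near_eq_derivable _ _ _ (cst (1 : R[i]^o))); last first.
    exact: derivable_cst.
  have : nbhs z V by exact: open_nbhs_nbhs.
  by apply: filterS => w Vw; rewrite valL0_1.
- move=> f g /asboolP Cf /asboolP Cg; apply/asboolP => z Vz; rewrite valL0B.
  by apply: derivableB; [exact: Cf|exact: Cg].
- move=> f g /asboolP Cf /asboolP Cg; apply/asboolP => z Vz; rewrite valL0M.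
  by apply: derivableM; [exact: Cf|exact: Cg].
Qed.

HB.instance Definition _ := GRing.isSubringClosed.Build (V -> R[i])
  (holomorphic hV) holomorphic_subring.

Record holomorphic_ring := Holomorphic {
  holomorphic_val :> V -> R[i];
  holomorphic_valP : holomorphic_val \in holomorphic hV }.

HB.instance Definition _ := [isSub for holomorphic_val].
HB.instance Definition _ := [Choice of holomorphic_ring by <:].
HB.instance Definition _ :=
  GRing.SubChoice_isSubComPzRing.Build _ _ holomorphic_ring
    (subringClosedP _).

End Holomorphic.

End Subring.

(* Main.v *)
Require Import Defs.
From HB Require Import structures.
From mathcomp Require Import all_boot all_order all_algebra.
From mathcomp Require Import all_classical all_reals all_analysis.
From mathcomp Require Import complex.
From mathcomp Require Import ring lra.

Set Implicit Arguments.
Unset Strict Implicit.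
Unset Printing Implicit Defensive.

Import Order.TTheory GRing.Theory Num.Theory.
Import numFieldNormedType.Exports.

Local Open Scope classical_set_scope.
Local Open Scope ring_scope.
Local Open Scope complex_scope.

(** Rigidity of [lambda] makes [xi] itself a solution: [xi_x = - lambda xi_y].
    Every rigid [f] satisfies [f_x = - lambda f_y] too, so its real differential
    is [f_y (dy - lambda dx) = (f_y / xi_y) d xi]: it is complex linear in the
    coordinate [xi], with complex derivative [f_y / xi_y].  Moreover
    [Phi = (lambda - conj lambda) conj xi_y], so [Phi <> 0] says that [xi_y <> 0],
    i.e. that the Jacobian [Im lambda |xi_y|^2] of [xi] does not vanish.

    Openness of [xi] is obtained without the inverse function theorem, by
    minimizing [|xi q - w|^2] over a small square around [p], using global
    injectivity to keep the minimum away from the boundary.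

    Complex differentiability is only assumed pointwise, so that [g \o xi] being
    [C^1] requires Goursat's theorem.  We prove it for real closed 1-forms that
    are merely differentiable, and apply it in polar coordinates around [z] to
    [f(w) dw / (w - z)^2]; this expresses [f'(z)] as an average of [f] over a
    circle of fixed radius, which is continuous in [z]. *)

(** * Closed 1-forms on a rectangle *)

(** Monotonicity puts every left end below every right end, so the supremum of the left ends lies in
    all the intervals. *)
Lemma nested_itv (R : realType) (a b : nat -> R) :
  (forall n, a n <= a n.+1) -> (forall n, b n.+1 <= b n) ->
  (forall n, a n <= b n) -> exists x, forall n, a n <= x <= b n.
Proof.
move=> a_le b_ge ab.
have nda : nondecreasing_seq a by apply/nondecreasing_seqP.
have nib : nonincreasing_seq b by apply/nonincreasing_seqP.
have ab' m n : a m <= b n.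
  have [mn|/ltnW nm] := leqP m n; first exact: le_trans (nda _ _ mn) (ab n).
  exact: le_trans (ab m) (nib _ _ nm).
exists (sup (range a)) => n; apply/andP; split.
  apply: ub_le_sup; last by exists n.
  by exists (b 0%N) => _ [m _ <-].
apply: ge_sup; first by exists (a 0%N), 0%N.
by move=> _ [m _ <-].
Qed.

(** Repeatedly choosing a quarter that inherits [P] gives nested rectangles; [nested_itv] in each
    coordinate gives their common point. *)
Lemma bisection_itv (R : realType) (P : R -> R -> R -> R -> Prop) (a b c d : R) :
  a <= b -> c <= d -> P a b c d ->
  (forall a b c d, a <= b -> c <= d -> P a b c d ->
    let m := (a + b) / 2 in let n := (c + d) / 2 in
    [\/ P a m c n, P m b c n, P a m n d | P m b n d]) ->
  exists x y, [/\ a <= x <= b, c <= y <= d & forall k, exists a' b' c' d',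
    [/\ a <= a' <= x /\ x <= b' <= b, c <= c' <= y /\ y <= d' <= d,
        b' - a' = (b - a) / 2 ^+ k, d' - c' = (d - c) / 2 ^+ k &
        P a' b' c' d']].
Proof.
move=> ab cd Pabcd H.
pose good (r : (R * R) * (R * R)) :=
  [/\ r.1.1 <= r.1.2, r.2.1 <= r.2.2 & P r.1.1 r.1.2 r.2.1 r.2.2].
pose child (r s : (R * R) * (R * R)) :=
  [/\ good s, r.1.1 <= s.1.1 /\ s.1.2 <= r.1.2,
      r.2.1 <= s.2.1 /\ s.2.2 <= r.2.2,
      s.1.2 - s.1.1 = (r.1.2 - r.1.1) / 2 &
      s.2.2 - s.2.1 = (r.2.2 - r.2.1) / 2].
(* A rectangle that is not [good] is sent to itself, only to make [f] total. *)
have /choice[f fP] r : exists s, good r -> child r s.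
  have [|ngr] := pselect (good r); last by exists r.
  case: r => -[p q] [s t] [/= pq st Pr].
  have := H _ _ _ _ pq st Pr; rewrite /=.
  set m := (p + q) / 2; set n := (s + t) / 2.
  have pm : p <= m by rewrite /m; lra.
  have mq : m <= q by rewrite /m; lra.
  have sn : s <= n by rewrite /n; lra.
  have nt : n <= t by rewrite /n; lra.
  move=> [Q|Q|Q|Q]; [exists (p, m, (s, n))|exists (m, q, (s, n))|
    exists (p, m, (n, t))|exists (m, q, (n, t))] => _;
    by split; rewrite /good /=; (try split); rewrite ?/m ?/n //; lra.
pose r k := iter k f ((a, b), (c, d)).
have gr k : good (r k).
  by elim: k => [//|k IH]; have [] := fP _ IH.
have cr k : child (r k) (r k.+1) by exact: fP.
have [x xP] : exists x, forall k, (r k).1.1 <= x <= (r k).1.2.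
  by apply: nested_itv => k; [have [_ []] := cr k|have [_ []] := cr k
    |have [] := gr k].
have [y yP] : exists y, forall k, (r k).2.1 <= y <= (r k).2.2.
  by apply: nested_itv => k; [have [_ _ []] := cr k|have [_ _ []] := cr k
    |have [] := gr k].
exists x, y; split; [exact: xP 0%N|exact: yP 0%N|] => k.
exists (r k).1.1, (r k).1.2, (r k).2.1, (r k).2.2.
have /andP[-> ->] := xP k; have /andP[-> ->] := yP k.
suff [i1 i2 i3 i4 [i5 i6]] : [/\ a <= (r k).1.1, (r k).1.2 <= b,
    c <= (r k).2.1, (r k).2.2 <= d & (r k).1.2 - (r k).1.1 = (b - a) / 2 ^+ k /\
    (r k).2.2 - (r k).2.1 = (d - c) / 2 ^+ k].
  by rewrite i1 i2 i3 i4 i5 i6; split=> //; have [] := gr k.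
elim: k => [|k [i1 i2 i3 i4 [i5 i6]]].
  by rewrite /= !expr0 !divr1.
have [_ [c1 c2] [c3 c4] -> ->] := cr k.
rewrite i5 i6 exprS invfM; split; last (by split; ring).
- exact: le_trans c1.
- exact: le_trans c2 _.
- exact: le_trans c3.
- exact: le_trans c4 _.
Qed.

Lemma differentiable_le (K : numFieldType) (V W : normedModType K)
    (f : V -> W) (x : V) (e : K) : differentiable f x -> 0 < e ->
  \forall y \near x, `|f y - f x - 'd f x (y - x)| <= e * `|y - x|.
Proof.
move=> /diff_locally df e0.
have /eqaddoP /(_ e e0) : f \o shift x = cst (f x) + 'd f x +o_ 0 id by [].
rewrite (near_shift 0 x); apply: filterS => y /=.
by rewrite !fctE /= subr0 addrK opprD addrA.
Qed.

(** The base value [w] cancels in the increment [u - v], at the price of doubling the error. *)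
Lemma ler_dist_increment (R : realDomainType) (u v w x y k : R) :
  `|u - w - x| <= k -> `|v - w - y| <= k -> `|u - v - (x - y)| <= 2 * k.
Proof.
move=> uk vk; rewrite (_ : _ - _ = u - w - x - (v - w - y)); last by ring.
by apply: le_trans (ler_normB _ _) _; rewrite mulr_natl mulr2n lerD.
Qed.

(* The affine part of a closed form does not contribute to the boundary sum,
   which the mean value theorem turns into two increments of [P] and [Q]. *)
Lemma goursat (R : realType) (P Q : R * R -> R) (F G : R -> R -> R)
    (a b c d : R) : a <= b -> c <= d ->
  (forall s t, a <= s <= b -> c <= t <= d ->
    is_derive s 1 (F ^~ t) (P (s, t))) ->
  (forall s t, a <= s <= b -> c <= t <= d ->
    is_derive t 1 (G s) (Q (s, t))) ->
  (forall s t, a <= s <= b -> c <= t <= d ->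
    [/\ differentiable P (s, t), differentiable Q (s, t) &
        'd P (s, t) (0, 1) = 'd Q (s, t) (1, 0)]) ->
  F b c - F a c + (G b d - G b c) = F b d - F a d + (G a d - G a c).
Proof.
move=> ab cd dF dG PQ.
pose S a b c d := F b c - F a c + (G b d - G b c) - (F b d - F a d) -
  (G a d - G a c).
apply/eqP; rewrite -subr_eq0 opprD addrA -[X in X == 0]/(S a b c d).
apply/eqP; apply: contrapT => /eqP; rewrite -normr_gt0 => S0.
have ab' : a < b.
  rewrite lt_neqAle ab andbT; apply: contraTN S0 => /eqP ->.
  by rewrite /S !subrr add0r subr0 subrr normr0 ltxx.
have cd' : c < d.
  rewrite lt_neqAle cd andbT; apply: contraTN S0 => /eqP ->.
  by rewrite /S !subrr addr0 subr0 subrr normr0 ltxx.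
have A0 : 0 < (b - a) * (d - c) by rewrite mulr_gt0 ?subr_gt0.
(* The invariant, stated without division: the ratio of [|S|] to the area is at least that of the
   whole rectangle. Since [S] is additive over the four quarters, one of them keeps it. *)
have [||x [y [xab ycd H]]] := @bisection_itv R
  (fun a' b' c' d' => `|S a b c d| * ((b' - a') * (d' - c')) <=
     `|S a' b' c' d'| * ((b - a) * (d - c))) a b c d ab cd.
- exact: lexx.
- move=> a1 b1 c1 d1 ab1 cd1 bad1 m n.
  pose X := `|S a b c d| * ((b1 - a1) * (d1 - c1) / 4).
  have [-> -> -> ->] : [/\ (m - a1) * (n - c1) = (b1 - a1) * (d1 - c1) / 4,
      (b1 - m) * (n - c1) = (b1 - a1) * (d1 - c1) / 4,
      (m - a1) * (d1 - n) = (b1 - a1) * (d1 - c1) / 4 &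
      (b1 - m) * (d1 - n) = (b1 - a1) * (d1 - c1) / 4].
    by rewrite /m /n; split; field.
  rewrite -/X; set A := (b - a) * (d - c) in A0 bad1 *.
  case: (leP X (`|S a1 m c1 n| * A)) => [?|l1]; first by constructor 1.
  case: (leP X (`|S m b1 c1 n| * A)) => [?|l2]; first by constructor 2.
  case: (leP X (`|S a1 m n d1| * A)) => [?|l3]; first by constructor 3.
  case: (leP X (`|S m b1 n d1| * A)) => [?|l4]; first by constructor 4.
  have : `|S a1 b1 c1 d1| * A <= (`|S a1 m c1 n| + `|S m b1 c1 n| +
      `|S a1 m n d1| + `|S m b1 n d1|) * A.
    rewrite ler_pM2r //.
    have -> : S a1 b1 c1 d1 = S a1 m c1 n + S m b1 c1 n + S a1 m n d1 +
        S m b1 n d1 by rewrite /S; ring.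
    by do 2 (apply: le_trans (ler_normD _ _) _; rewrite lerD2r);
       exact: ler_normD.
  by move: bad1 l1 l2 l3 l4; rewrite /X; clearbody A; lra.
pose L := b - a + (d - c).
have L0 : 0 < L by rewrite /L; lra.
have [dP dQ PQxy] := PQ x y xab ycd.
(* The final bound [2 * e * l ^+ 2] becomes two thirds of the lower bound that bisection gives for
   the same quantity, a contradiction. *)
pose e := `|S a b c d| / (3 * L ^+ 2).
have e0 : 0 < e by rewrite divr_gt0 // mulr_gt0 ?exprn_gt0.
have : \forall p \near (x, y),
    `|P p - P (x, y) - 'd P (x, y) (p - (x, y))| <= e * `|p - (x, y)| /\
    `|Q p - Q (x, y) - 'd Q (x, y) (p - (x, y))| <= e * `|p - (x, y)|.
  exact: (filterI (differentiable_le dP e0) (differentiable_le dQ e0)).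
move=> /nbhs_normP[r /= r0 rPQ].
have [k kr] : exists k, L / 2 ^+ k < r.
  have rL : 0 < r / L by rewrite divr_gt0.
  have [k _ /(_ k (leqnn k))] := near_infty_natSinv_expn_lt (PosNum rL).
  by rewrite /= div1r ltr_pdivlMr // mulrC => ?; exists k.
have [a1 [b1 [c1 [d1 [[/andP[aa1 a1x] /andP[xb1 b1b]] [/andP[cc1 c1y]
  /andP[yd1 d1d]] ba1 dc1 bad1]]]]] := H k.
set l := L / 2 ^+ k in kr.
have l0 : 0 < l by rewrite divr_gt0 ?exprn_gt0.
have l1 : b1 - a1 + (d1 - c1) = l by rewrite ba1 dc1 -mulrDl.
have a1b1 : a1 <= b1 by exact: le_trans xb1.
have c1d1 : c1 <= d1 by exact: le_trans yd1.
have a1I : a1 <= a1 <= b1 by rewrite lexx.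
have b1I : a1 <= b1 <= b1 by rewrite lexx andbT.
have c1I : c1 <= c1 <= d1 by rewrite lexx.
have d1I : c1 <= d1 <= d1 by rewrite lexx andbT.
have subI s : a1 <= s <= b1 -> a <= s <= b.
  by move=> /andP[as1 sb1]; rewrite (le_trans aa1 as1) (le_trans sb1 b1b).
have subJ t : c1 <= t <= d1 -> c <= t <= d.
  by move=> /andP[ct1 td1]; rewrite (le_trans cc1 ct1) (le_trans td1 d1d).
have nearl s t : a1 <= s <= b1 -> c1 <= t <= d1 -> `|(s, t) - (x, y)| <= l.
  move=> /andP[as1 sb1] /andP[ct1 td1]; rewrite prod_normE /= ge_max.
  have in_itv_dist (p q u v : R) : p <= u <= q -> p <= v <= q -> q - p <= l ->
      `|u - v| <= l.
    by clear; rewrite ler_norml; lra.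
  have ? : 0 <= b1 - a1 by rewrite subr_ge0.
  have ? : 0 <= d1 - c1 by rewrite subr_ge0.
  apply/andP; split.
    apply: (in_itv_dist a1 b1); rewrite ?as1 ?a1x //.
    by rewrite -l1 lerDl.
  apply: (in_itv_dist c1 d1); rewrite ?ct1 ?c1y //.
  by rewrite -l1 lerDr.
have approx s t : a1 <= s <= b1 -> c1 <= t <= d1 ->
    `|P (s, t) - P (x, y) - 'd P (x, y) ((s, t) - (x, y))| <= e * l /\
    `|Q (s, t) - Q (x, y) - 'd Q (x, y) ((s, t) - (x, y))| <= e * l.
  move=> hs ht; have nst := nearl _ _ hs ht.
  have [|p q] := rPQ (s, t); first by rewrite /= distrC; exact: le_lt_trans kr.
  by split; [apply: le_trans p _|apply: le_trans q _]; rewrite ler_pM2l.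
have [s /[!in_itv]/= hs FE] : exists2 s, s \in `[a1, b1] &
    (F b1 c1 - F b1 d1) - (F a1 c1 - F a1 d1) =
    (P (s, c1) - P (s, d1)) * (b1 - a1).
  apply: (@MVT_segment R (fun s => F s c1 - F s d1)); first by [].
    move=> s /[!in_itv]/= /andP[/ltW ls /ltW rs].
    by apply: is_deriveB; apply: dF; auto; apply: subI; rewrite ls.
  apply: derivable_within_continuous => s /[!in_itv]/= hs.
  by apply: derivableB; apply: ex_derive; apply: dF; auto.
have [t /[!in_itv]/= ht GE] : exists2 t, t \in `[c1, d1] &
    (G b1 d1 - G a1 d1) - (G b1 c1 - G a1 c1) =
    (Q (b1, t) - Q (a1, t)) * (d1 - c1).
  apply: (@MVT_segment R (fun t => G b1 t - G a1 t)); first by [].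
    move=> t /[!in_itv]/= /andP[/ltW lt /ltW rt].
    by apply: is_deriveB; apply: dG; auto; apply: subJ; rewrite lt.
  apply: derivable_within_continuous => t /[!in_itv]/= ht.
  by apply: derivableB; apply: ex_derive; apply: dG; auto.
have SE : S a1 b1 c1 d1 = (P (s, c1) - P (s, d1)) * (b1 - a1) +
    (Q (b1, t) - Q (a1, t)) * (d1 - c1) by rewrite -FE -GE /S; ring.
have dPE : 'd P (x, y) ((s, c1) - (x, y)) - 'd P (x, y) ((s, d1) - (x, y)) =
    (c1 - d1) * 'd P (x, y) (0, 1).
  rewrite -linearB /= -[RHS]/(_ *: _) -linearZ /=; congr ('d P (x, y) _).
  by congr (_, _); rewrite /= /GRing.scale /= ?mulr1 ?mulr0; ring.
have dQE : 'd Q (x, y) ((b1, t) - (x, y)) - 'd Q (x, y) ((a1, t) - (x, y)) =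
    (b1 - a1) * 'd Q (x, y) (1, 0).
  rewrite -linearB /= -[RHS]/(_ *: _) -linearZ /=; congr ('d Q (x, y) _).
  by congr (_, _); rewrite /= /GRing.scale /= ?mulr1 ?mulr0; ring.
have Pe : `|P (s, c1) - P (s, d1) - (c1 - d1) * 'd P (x, y) (0, 1)| <=
    2 * (e * l).
  rewrite -dPE.
  exact: ler_dist_increment (approx s c1 hs c1I).1 (approx s d1 hs d1I).1.
have Qe : `|Q (b1, t) - Q (a1, t) - (b1 - a1) * 'd Q (x, y) (1, 0)| <=
    2 * (e * l).
  rewrite -dQE.
  exact: ler_dist_increment (approx b1 t b1I ht).2 (approx a1 t a1I ht).2.
have Sle : `|S a1 b1 c1 d1| <= 2 * e * l ^+ 2.
  (* The two linear terms subtracted here cancel by closedness, [PQxy]. *)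
  have -> : S a1 b1 c1 d1 =
    (P (s, c1) - P (s, d1) - (c1 - d1) * 'd P (x, y) (0, 1)) * (b1 - a1) +
    (Q (b1, t) - Q (a1, t) - (b1 - a1) * 'd Q (x, y) (1, 0)) * (d1 - c1).
    by rewrite SE -PQxy; ring.
  have -> : 2 * e * l ^+ 2 = 2 * (e * l) * (b1 - a1) + 2 * (e * l) * (d1 - c1).
    by rewrite -mulrDr l1; ring.
  apply: le_trans (ler_normD _ _) _; rewrite !normrM.
  rewrite (@ger0_norm _ (b1 - a1)) ?(@ger0_norm _ (d1 - c1)) ?subr_ge0 //.
  by apply: lerD; apply: ler_wpM2r; rewrite ?subr_ge0.
have : `|S a b c d| / (2 ^+ k) ^+ 2 <= 2 * e * l ^+ 2.
  apply: le_trans Sle; rewrite -(ler_pM2r A0); apply: le_trans bad1.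
  rewrite ba1 dc1 le_eqVlt; apply/orP; left; apply/eqP.
  by field; rewrite expf_neq0.
have -> : 2 * e * l ^+ 2 = 2 / 3 * (`|S a b c d| / (2 ^+ k) ^+ 2).
  by rewrite /e /l; field; rewrite (gt_eqF L0) expf_neq0.
have : 0 < `|S a b c d| / (2 ^+ k) ^+ 2.
  by rewrite divr_gt0 ?exprn_gt0.
by move: (_ / _ : R) => z; clear; lra.
Qed.

(** * Primitives of continuous functions of one variable *)

Lemma continuous_integrable_itv (R : realType) (f : R -> R) (a b : R) :
  continuous f -> (@lebesgue_measure R).-integrable `[a, b] (EFin \o f).
Proof.
move=> cf; apply: continuous_compact_integrable; first exact: segment_compact.
exact: continuous_subspaceT.
Qed.

Lemma is_derive_Rintegral (R : realType) (f : R -> R) (a x : R) :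
  continuous f -> a < x ->
  is_derive x 1 (fun y => \int[lebesgue_measure]_(t in `[a, y]) f t)%R (f x).
Proof.
move=> cf ax.
(* The right end [x + 1] serves only to make [x] an interior point. *)
have [dF F'] := @continuous_FTC1_closed R f a x (x + 1)
  ltac:(by rewrite ltrDl) (continuous_integrable_itv a (x + 1) cf) ax (cf x).
by split; [exact: dF|rewrite -derive1E; exact: F'].
Qed.

(** [F - G] has zero derivative. This allows an arbitrary primitive to be traded for an integral. *)
Lemma primitive_increment (R : realType) (f F G : R -> R) (a b : R) : a <= b ->
  (forall t, a <= t <= b -> is_derive t 1 F (f t)) ->
  (forall t, a <= t <= b -> is_derive t 1 G (f t)) ->
  F b - F a = G b - G a.
Proof.
move=> ab dF dG.
have [||t _] := @MVT_segment R (fun t => F t - G t) (cst 0) a b ab.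
- move=> t /[!in_itv]/= /andP[/ltW at_ /ltW tb].
  rewrite /cst -(subrr (f t)); apply: is_deriveB; [apply: dF|apply: dG];
    by rewrite at_.
- apply: derivable_within_continuous => t /[!in_itv]/= tab.
  by apply: derivableB; apply: ex_derive; [exact: dF|exact: dG].
by rewrite mul0r => /eqP; lra.
Qed.

(** * Differentials of real functions on the plane *)

Section DiffR2.
Context {R : realType}.
Implicit Types (p : R * R) (f g df dg : R * R -> R).

Lemma is_diff_fst p : is_diff p (fst : R * R -> R) fst.
Proof.
have cf : continuous (fst : R * R -> R) by move=> ?; exact: cvg_fst.
by apply: DiffDef; [exact: linear_differentiable|exact: diff_lin].
Qed.

Lemma is_diff_snd p : is_diff p (snd : R * R -> R) snd.
Proof.
have cf : continuous (snd : R * R -> R) by move=> ?; exact: cvg_snd.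
by apply: DiffDef; [exact: linear_differentiable|exact: diff_lin].
Qed.

Lemma is_derive_diff (f : R -> R) (x c : R) :
  is_derive x 1 f c -> is_diff x f ( *%R^~ c).
Proof.
move=> [df <-]; apply: DiffDef; first exact/derivable1_diffP.
by rewrite deriv1E // derive1E.
Qed.

Lemma is_diff_derive_comp (h : R -> R) f df p c :
  is_diff p f df -> is_derive (f p) 1 h c ->
  is_diff p (fun q => h (f q)) (fun q => df q * c).
Proof.
move=> dfp dh; have dh' := is_derive_diff dh.
exact: (@is_diff_comp _ _ _ _ f df h ( *%R^~ c) p).
Qed.

Lemma is_diff_mul f g df dg p : is_diff p f df -> is_diff p g dg ->
  is_diff p (fun q => f q * g q) (fun q => f p * dg q + g p * df q).
Proof. by move=> dfp dgp; exact: (@is_diffM _ _ f g df dg p). Qed.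

Lemma is_diff_add f g df dg p : is_diff p f df -> is_diff p g dg ->
  is_diff p (fun q => f q + g q) (fun q => df q + dg q).
Proof. by move=> dfp dgp; exact: (@is_diffD _ _ _ f g df dg p). Qed.

Lemma is_diff_sub f g df dg p : is_diff p f df -> is_diff p g dg ->
  is_diff p (fun q => f q - g q) (fun q => df q - dg q).
Proof. by move=> dfp dgp; exact: (@is_diffB _ _ _ f g df dg p). Qed.

Lemma is_diff_pair_comp (h dh f g df dg : R * R -> R) p :
  is_diff p f df -> is_diff p g dg -> is_diff (f p, g p) h dh ->
  is_diff p (fun q => h (f q, g q)) (fun q => dh (df q, dg q)).
Proof.
move=> dfp dgp dhp; have dp := @is_diff_pair _ _ _ _ f df g dg p dfp dgp.
exact: (@is_diff_comp _ _ _ _ (fun q => (f q, g q)) _ h dh p).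
Qed.

End DiffR2.

(** Composing with this retraction extends a function continuous on a segment to the whole line, as
    [is_derive_Rintegral] requires. *)
Lemma continuous_clamp (R : realType) (a b : R) :
  continuous (fun s : R => Num.min b (Num.max a s)).
Proof.
apply: (@min_fun_continuous _ _ _ (cst b) (fun s => Num.max a s)).
  by move=> ?; exact: cvg_cst.
apply: (@max_fun_continuous _ _ _ (cst a) id) => ?; last exact: cvg_id.
exact: cvg_cst.
Qed.

(** * Continuity of the complex derivative *)

Section CauchyRiemann.
Context {R : realType}.
Implicit Types (u v : R * R -> R) (z p : R * R).

(** Both differentials together are multiplication by [a + i b]: this says that [u + i v] has
    complex derivative [a + i b] at [p]. *)
Definition cauchy_riemann u v p (a b : R) :=
  is_diff p u (fun h => a * h.1 - b * h.2) /\
  is_diff p v (fun h => b * h.1 + a * h.2).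

Definition polar z (s t : R) : R * R := (z.1 + s * cos t, z.2 + s * sin t).

(* [Re (f(z + s e^(it)) e^(-it))] for [f = u + iv] *)
Definition radial u v z (s t : R) : R :=
  u (polar z s t) * cos t + v (polar z s t) * sin t.

Lemma is_diff_polar u du z (s t : R) : is_diff (polar z s t) u du ->
  is_diff (s, t) (fun q => u (polar z q.1 q.2))
    (fun h => du (s * (h.2 * - sin t) + cos t * h.1,
                  s * (h.2 * cos t) + sin t * h.1)).
Proof.
move=> dfu.
have dcos := is_diff_derive_comp (is_diff_snd (s, t)) (is_derive_cos t).
have dsin := is_diff_derive_comp (is_diff_snd (s, t)) (is_derive_sin t).
have dcst (c : R) : is_diff (s, t) (cst c : R * R -> R) 0 by exact: is_diff_cst.
have d1 := is_diff_add (dcst z.1) (is_diff_mul (is_diff_fst (s, t)) dcos).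
have d2 := is_diff_add (dcst z.2) (is_diff_mul (is_diff_fst (s, t)) dsin).
apply: is_diff_eq (is_diff_pair_comp d1 d2 dfu) _.
by apply/funext => h /=; rewrite !add0r.
Qed.

(** With [w = z + s e^(it)], the form [f(w) dw / (w - z)^2] equals
    [f e^(-it) (ds / s^2 + i dt / s)]; its imaginary part is [P ds + Q dt]. *)
Lemma polar_form_closed u v z (a b s t : R) : s != 0 ->
  cauchy_riemann u v (polar z s t) a b ->
  let P q := (v (polar z q.1 q.2) * cos q.2 - u (polar z q.1 q.2) * sin q.2)
    * (q.1 ^- 2) in
  let Q q := radial u v z q.1 q.2 * q.1^-1 in
  [/\ differentiable P (s, t), differentiable Q (s, t) &
      'd P (s, t) (0, 1) = 'd Q (s, t) (1, 0)].
Proof.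
move=> s0 [du dv] P Q.
have dcos := is_diff_derive_comp (is_diff_snd (s, t)) (is_derive_cos t).
have dsin := is_diff_derive_comp (is_diff_snd (s, t)) (is_derive_sin t).
have dU := is_diff_polar du; have dV := is_diff_polar dv.
have dinv : is_derive s 1 (fun x : R => x^-1) (- s ^- 2).
  apply: is_derive_eq (@is_deriveV _ id s 1 1 s0 (is_derive_id _ _)) _.
  exact: mulr1.
have dinv2 : is_derive s 1 (fun x : R => x ^- 2) (- (s ^+ 2) ^- 2 * (2 * s)).
  have dX : is_derive s 1 (fun x : R => x ^+ 2) (2 * s).
    apply: is_derive_eq (@is_deriveM _ _ id id s 1 1 1 (is_derive_id _ _)
      (is_derive_id _ _)) _.
    by rewrite /GRing.scale /= mulr1 mulr_natl.
  have s20 : s ^+ 2 != 0 by rewrite expf_neq0.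
  by apply: is_derive_eq (@is_deriveV _ (fun x => x ^+ 2) s _ _ s20 dX) _.
have dP := is_diff_mul (is_diff_sub (is_diff_mul dV dcos) (is_diff_mul dU dsin))
  (is_diff_derive_comp (is_diff_fst (s, t)) dinv2).
have dQ := is_diff_mul (is_diff_add (is_diff_mul dU dcos) (is_diff_mul dV dsin))
  (is_diff_derive_comp (is_diff_fst (s, t)) dinv).
split; [exact: (@ex_diff _ _ _ _ _ _ _ dP)|exact: (@ex_diff _ _ _ _ _ _ _ dQ)|].
rewrite (@diff_val _ _ _ _ _ _ _ dP) (@diff_val _ _ _ _ _ _ _ dQ) /=.
have S2 : sin t ^+ 2 = 1 - cos t ^+ 2 by rewrite -(cos2Dsin2 t) addrAC subrr add0r.
move: (sin t) (cos t) S2 (u _) (v _) => S C S2 U V.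
by clear -s0 S2; field: S2.
Qed.

(** [goursat] is applied for radii in [[s, r]] and angles in [[0, 2 pi]]: the sides at angles [0]
    and [2 pi] cancel by periodicity, which leaves the two circles. *)
Lemma radial_primitive_increment u v z (s r : R) (G H : R -> R) : 0 < s <= r ->
  (forall x t, s <= x <= r -> exists a b, cauchy_riemann u v (polar z x t) a b) ->
  (forall t : R, 0 <= t <= pi *+ 2 -> is_derive t 1 G (radial u v z s t / s)) ->
  (forall t : R, 0 <= t <= pi *+ 2 -> is_derive t 1 H (radial u v z r t / r)) ->
  G (pi *+ 2) - G 0 = H (pi *+ 2) - H 0.
Proof.
move=> /andP[s0 sr] CR dG dH.
pose P (q : R * R) := (v (polar z q.1 q.2) * cos q.2 -
  u (polar z q.1 q.2) * sin q.2) * (q.1 ^- 2).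
pose Q (q : R * R) := radial u v z q.1 q.2 * q.1^-1.
have closed x t : s <= x <= r -> [/\ differentiable P (x, t),
    differentiable Q (x, t) & 'd P (x, t) (0, 1) = 'd Q (x, t) (1, 0)].
  move=> xI; have [a [b ab]] := CR x t xI.
  apply: polar_form_closed ab.
  by case/andP: xI => sx _; rewrite gt_eqF // (lt_le_trans s0).
(* [P] is controlled only for radii in [[s, r]]; clamping makes the integrand continuous everywhere
   and leaves it unchanged there. *)
pose clamp x := Num.min r (Num.max s x).
have clampI x : s <= clamp x <= r.
  by rewrite /clamp ge_min lexx /= andbT le_min sr le_max lexx.
have clampE x : s <= x <= r -> clamp x = x.
  by move=> /andP[sx xr]; rewrite /clamp (max_idPr sx) (min_idPr xr).
(* The base points [s / 2] and [-1] lie strictly to the left of the ranges used, so the primitives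
   have two-sided derivatives at the end points too. *)
pose F x t := (\int[lebesgue_measure]_(y in `[s / 2, x]) P (clamp y, t))%R.
pose K x t := (\int[lebesgue_measure]_(y in `[-1, t]) Q (x, y))%R.
have s2 : s / 2 < s by rewrite ltr_pdivrMr // ltr_pMr // ltr1n.
have dF x t : s <= x <= r -> is_derive x 1 (F ^~ t) (P (x, t)).
  move=> xI; rewrite -{2}(clampE x xI); apply: is_derive_Rintegral; last first.
    by case/andP: xI => sx _; exact: lt_le_trans sx.
  move=> y; have c1 : {for y, continuous (fun y => (clamp y, t))}.
    exact: (cvg_pair (@continuous_clamp _ s r y) (cvg_cst t)).
  have [/differentiable_continuous c2 _ _] := closed (clamp y) t (clampI y).
  exact: continuous_comp c1 c2.
have dK x (t : R) : s <= x <= r -> 0 <= t -> is_derive t 1 (K x) (Q (x, t)).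
  move=> xI t0; apply: is_derive_Rintegral; last first.
    by apply: lt_le_trans t0; rewrite oppr_lt0.
  move=> y; have c1 : {for y, continuous (fun y => (x, y))}.
    exact: (cvg_pair (cvg_cst x) cvg_id).
  have [_ /differentiable_continuous c2 _] := closed x y xI.
  exact: continuous_comp c1 c2.
have pi0 : 0 <= pi *+ 2 :> R by rewrite mulrn_wge0 // pi_ge0.
have sI : s <= s <= r by rewrite lexx.
have rI : s <= r <= r by rewrite sr lexx.
have := @goursat R P Q F K s r 0 (pi *+ 2) sr pi0 (fun x t xI _ => dF x t xI)
  (fun x t xI tI => dK x t xI (andP tI).1) (fun x t xI _ => closed x t xI).
have -> : G (pi *+ 2) - G 0 = K s (pi *+ 2) - K s 0.
  exact: (@primitive_increment R (fun t => radial u v z s t / s) G (K s)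
    0 (pi *+ 2) pi0 dG (fun t tI => dK s t sI (andP tI).1)).
have -> : H (pi *+ 2) - H 0 = K r (pi *+ 2) - K r 0.
  exact: (@primitive_increment R (fun t => radial u v z r t / r) H (K r)
    0 (pi *+ 2) pi0 dH (fun t tI => dK r t rI (andP tI).1)).
have FE x : F x (pi *+ 2) = F x 0.
  rewrite /F; congr (Rintegral _ _ _); apply/funext => y.
  by rewrite /P /polar /= sin2pi cos2pi sin0 cos0.
by rewrite !FE => /addrI ->.
Qed.

End CauchyRiemann.

(** * Cauchy's formula for the derivative *)

Section CauchyFormula.
Context {R : realType}.
Implicit Types (u v : R * R -> R) (z p : R * R).

Lemma continuous_radial u v z (s : R) : s != 0 ->
  (forall t, exists a b, cauchy_riemann u v (polar z s t) a b) ->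
  continuous (fun t => radial u v z s t / s).
Proof.
move=> s0 CR t; have [a [b ab]] := CR t.
have [_ /differentiable_continuous c2 _] := polar_form_closed s0 ab.
have c1 : {for t, continuous (fun t => (s, t))}.
  exact: (cvg_pair (cvg_cst s) cvg_id).
exact: continuous_comp c1 c2.
Qed.

Lemma norm_polarB z (s t : R) : 0 <= s -> `|polar z s t - z| <= s.
Proof.
move=> s0; have lecos (c : R) : `|c| <= 1 -> `|s * c| <= s.
  by move=> c1; rewrite normrM (ger0_norm s0) ler_piMr.
have cos1 : `|cos t| <= 1 by rewrite ler_norml cos_geN1 cos_le1.
have sin1 : `|sin t| <= 1 by rewrite ler_norml sin_geN1 sin_le1.
rewrite prod_normE /= ge_max /polar /=.
by rewrite !(addrC _ (_ * _)) !addrK !lecos.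
Qed.

Lemma cauchy_riemann_near u v z (a b e : R) : cauchy_riemann u v z a b ->
  0 < e -> \forall p \near z,
    `|u p - u z - (a * (p.1 - z.1) - b * (p.2 - z.2))| <= e * `|p - z| /\
    `|v p - v z - (b * (p.1 - z.1) + a * (p.2 - z.2))| <= e * `|p - z|.
Proof.
move=> [du dv] e0.
have du' := @ex_diff _ _ _ _ _ _ _ du; have dv' := @ex_diff _ _ _ _ _ _ _ dv.
apply: filterS (filterI (differentiable_le du' e0) (differentiable_le dv' e0)).
by move=> p /=; rewrite (@diff_val _ _ _ _ _ _ _ du) (@diff_val _ _ _ _ _ _ _ dv).
Qed.

(* [f'(z) = 1 / (2 pi r) * \int_0^(2 pi) f(z + r e^(it)) e^(-it) dt], real part:
   the integral does not depend on the radius, by [goursat] in polar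
   coordinates applied to [f(w) dw / (w - z)^2]; then let the radius tend to 0. *)
Lemma cauchy_derivative u v z (a b r : R) (G : R -> R) : 0 < r ->
  cauchy_riemann u v z a b ->
  (forall s t, 0 < s <= r -> exists a b, cauchy_riemann u v (polar z s t) a b) ->
  (forall t : R, 0 <= t <= pi *+ 2 -> is_derive t 1 G (radial u v z r t / r)) ->
  G (pi *+ 2) - G 0 = a * (pi *+ 2).
Proof.
move=> r0 CRz CR dG.
pose p2 : R := pi *+ 2.
have p20 : 0 < p2 by rewrite /p2 mulrn_wgt0 // pi_gt0.
suff H e : 0 < e -> `|G p2 - G 0 - a * p2| <= 2 * e * p2.
  apply/eqP; rewrite -subr_eq0 -normr_le0; apply/ler_addgt0Pl => e e0.
  rewrite addr0; have e1 : 0 < e / (2 * p2) by rewrite divr_gt0 // mulr_gt0.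
  apply: le_trans (H _ e1) _.
  by rewrite mulrAC mulrC divfK // mulf_neq0 // gt_eqF.
move=> e0.
have /nbhs_normP[d /= d0 nearz] := cauchy_riemann_near CRz e0.
(* Small enough for the first-order estimate around [z], and at most [r] so that the circle of
   radius [r] can be shrunk to it. *)
pose s := Num.min r (d / 2).
have s0 : 0 < s by rewrite lt_min r0 divr_gt0.
have sr : s <= r by rewrite ge_min lexx.
have sd : s < d.
  by rewrite gt_min; apply/orP; right; rewrite ltr_pdivrMr // ltr_pMr // ltr1n.
pose K t := (\int[lebesgue_measure]_(y in `[-1, t]) (radial u v z s y / s))%R.
have dK (t : R) : 0 <= t -> is_derive t 1 K (radial u v z s t / s).
  move=> t0; apply: is_derive_Rintegral; last first.
    by apply: lt_le_trans t0; rewrite oppr_lt0.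
  by apply: continuous_radial => [|x]; rewrite ?gt_eqF //; apply: CR; rewrite s0.
have <- : K p2 - K 0 = G p2 - G 0.
  apply: (@radial_primitive_increment _ u v z s r) => //; first by rewrite s0.
    by move=> x t /andP[sx xr]; apply: CR; rewrite xr (lt_le_trans s0).
  by move=> t /andP[t0 _]; exact: dK.
(* A primitive of the integrand obtained when [f] is replaced by [f(z) + f'(z) (w - z)]: the
   constant term integrates to zero over a period and the linear one contributes [a]. *)
pose L t := (u z * sin t - v z * cos t) / s + a * t.
have dL (t : R) : is_derive t 1 L ((u z * cos t + v z * sin t) / s + a).
  have dc (c l : R) (f : R -> R) : is_derive t 1 f l ->
      is_derive t 1 (fun x => c * f x) (c * l).
    by move=> df; exact: is_deriveZ.
  have d1 := is_deriveB (dc (u z) _ _ (is_derive_sin t))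
    (dc (v z) _ _ (is_derive_cos t)).
  apply: is_derive_eq (is_deriveD (is_deriveM d1 (is_derive_cst s^-1 t 1))
    (dc a _ _ (is_derive_id t 1))) _.
  by rewrite /GRing.scale /=; ring.
have L2pi : L p2 - L 0 = a * p2.
  by rewrite /L /p2 sin2pi cos2pi sin0 cos0; ring.
rewrite -L2pi (_ : _ - _ = (K p2 - L p2) - (K 0 - L 0)); last by ring.
have [||t /[!in_itv]/= t02 ->] := @MVT_segment R (fun t => K t - L t)
  (fun t => radial u v z s t / s - ((u z * cos t + v z * sin t) / s + a))
  0 p2 (ltW p20).
- move=> t /[!in_itv]/= /andP[/ltW t0 _].
  exact: (is_deriveB (dK t t0) (dL t)).
- apply: derivable_within_continuous => t /[!in_itv]/= /andP[t0 _].
  have dKt := dK t t0; have dLt := dL t.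
  by apply: derivableB; apply: ex_derive.
rewrite subr0 normrM (ger0_norm (ltW p20)) ler_pM2r //.
have near_ps : `|polar z s t - z| <= s by apply: norm_polarB; exact: ltW.
have [|up vp] := nearz (polar z s t).
  by rewrite /= distrC (le_lt_trans near_ps).
have {up} := le_trans up (ler_wpM2l (ltW e0) near_ps).
have {vp} := le_trans vp (ler_wpM2l (ltW e0) near_ps).
rewrite /radial.
have -> : (polar z s t).1 - z.1 = s * cos t by rewrite /polar /= addrC addKr.
have -> : (polar z s t).2 - z.2 = s * sin t by rewrite /polar /= addrC addKr.
have S2 : sin t ^+ 2 = 1 - cos t ^+ 2 by rewrite -(cos2Dsin2 t) addrAC subrr add0r.
have cos1 : `|cos t| <= 1 by rewrite ler_norml cos_geN1 cos_le1.
have sin1 : `|sin t| <= 1 by rewrite ler_norml sin_geN1 sin_le1.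
move: (u (polar z s t)) (v (polar z s t)) (sin t) (cos t) S2 cos1 sin1.
move=> U V S C S2 C1 S1.
set x := U - _ - _; set y := V - _ - _ => ye xe.
have -> : (U * C + V * S) / s - ((u z * C + v z * S) / s + a) =
    (x * C + y * S) / s.
  by rewrite /x /y; field: S2; rewrite gt_eqF.
rewrite normrM normfV (gtr0_norm s0) ler_pdivrMr //.
apply: le_trans (ler_normD _ _) _; rewrite !normrM.
have es0 : 0 <= e * s by rewrite mulr_ge0 // ltW.
have -> : 2 * e * s = e * s * 1 + e * s * 1 by ring.
by apply: lerD; apply: ler_pM.
Qed.
End CauchyFormula.

Section ContinuousDerivative.
Context {R : realType}.
Implicit Types (u v : R * R -> R) (z p : R * R).

Lemma cvg_polar z (s t : R) :
  polar q.2 s q.1 @[q --> (t, z)] --> polar z s t.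
Proof.
have c1 : q.1 @[q --> (t, z)] --> t by exact: cvg_fst.
have c2 : q.2 @[q --> (t, z)] --> z by exact: cvg_snd.
have ccos : cos q.1 @[q --> (t, z)] --> cos t.
  exact: continuous_comp c1 (@continuous_cos R t).
have csin : sin q.1 @[q --> (t, z)] --> sin t.
  exact: continuous_comp c1 (@continuous_sin R t).
have c21 : q.2.1 @[q --> (t, z)] --> z.1 by exact: continuous_comp c2 cvg_fst.
have c22 : q.2.2 @[q --> (t, z)] --> z.2 by exact: continuous_comp c2 cvg_snd.
exact: (cvg_pair (cvgD c21 (cvgM (cvg_cst s) ccos))
  (cvgD c22 (cvgM (cvg_cst s) csin))).
Qed.

(** [radial] is jointly continuous in the angle and the centre; compactness of [[0, 2 pi]], in its
    near-covering form, makes the estimate uniform in the angle. *)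
Lemma radial_near u v z (s e : R) : 0 < e ->
  (forall t, {for polar z s t, continuous u}) ->
  (forall t, {for polar z s t, continuous v}) ->
  \forall p \near z, forall t, 0 <= t <= pi *+ 2 ->
    `|radial u v p s t - radial u v z s t| < e.
Proof.
move=> e0 cu cv.
have /compact_near_coveringP cpt := @segment_compact R 0 (pi *+ 2).
pose P p t := `|radial u v p s t - radial u v z s t| < e.
have near_pt t : `[0, pi *+ 2]%classic t -> \forall t' \near t & p \near z, P p t'.
  move=> _; have cfst : q.1 @[q --> (t, z)] --> t by exact: cvg_fst.
  have ccos : cos q.1 @[q --> (t, z)] --> cos t.
    exact: continuous_comp cfst (@continuous_cos R t).
  have csin : sin q.1 @[q --> (t, z)] --> sin t.
    exact: continuous_comp cfst (@continuous_sin R t).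
  have cpz : polar z s q.1 @[q --> (t, z)] --> polar z s t.
    have c1 : (q.1, z) @[q --> (t, z)] --> (t, z).
      exact: cvg_pair cfst (cvg_cst z).
    exact: cvg_comp c1 (@cvg_polar z s t).
  have crad (f : R * (R * R) -> R * R) : f q @[q --> (t, z)] --> polar z s t ->
      u (f q) * cos q.1 + v (f q) * sin q.1 @[q --> (t, z)] --> radial u v z s t.
    move=> cf.
    have cuf : u (f q) @[q --> (t, z)] --> u (polar z s t).
      exact: cvg_comp cf (cu t).
    have cvf : v (f q) @[q --> (t, z)] --> v (polar z s t).
      exact: cvg_comp cf (cv t).
    exact: (cvgD (cvgM cuf ccos) (cvgM cvf csin)).
  have c0 : radial u v q.2 s q.1 - radial u v z s q.1 @[q --> (t, z)] --> (0 : R).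
    rewrite -(subrr (radial u v z s t)).
    exact: (cvgB (crad _ (@cvg_polar z s t)) (crad _ cpz)).
  by have /cvgr0Pnorm_lt := c0; apply.
apply: filterS (cpt _ _ P _ near_pt) => p Pp t t02.
by apply: Pp; rewrite /= in_itv.
Qed.

(** Circles of radius [r = d / 2] centred within [r] of [z] stay in the [d]-ball, so
    [cauchy_derivative] expresses every nearby [a p] with one common radius. [radial_near] and the
    mean value theorem then compare the increments. *)
Lemma cauchy_riemann_continuous_l u v (V : set (R * R)) (a b : R * R -> R) z :
  open V -> (forall p, V p -> cauchy_riemann u v p (a p) (b p)) -> V z ->
  {for z, continuous a}.
Proof.
move=> oV CR Vz.
have /nbhs_normP[d /= d0 ballV] : nbhs z V by exact: open_nbhs_nbhs.
pose r := d / 2.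
have r0 : 0 < r by rewrite divr_gt0.
have Vpolar p s t : `|p - z| < r -> 0 <= s <= r -> V (polar p s t).
  move=> pz /andP[s0 sr]; apply: ballV; rewrite /= distrC.
  rewrite (_ : _ - z = polar p s t - p + (p - z)); last by rewrite addrA subrK.
  rewrite (le_lt_trans (ler_normD _ _)) // [ltRHS](splitr d).
  by rewrite ler_ltD // (le_trans (norm_polarB _ _ _)).
pose G p t := (\int[lebesgue_measure]_(y in `[-1, t]) (radial u v p r y / r))%R.
have dG p (t : R) : `|p - z| < r -> 0 <= t ->
    is_derive t 1 (G p) (radial u v p r t / r).
  move=> pz t0; apply: is_derive_Rintegral; last first.
    by apply: lt_le_trans t0; rewrite oppr_lt0.
  apply: continuous_radial => [|x]; first by rewrite gt_eqF.
  exists (a (polar p r x)), (b (polar p r x)); apply: CR; apply: Vpolar => //.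
  by rewrite lexx ltW.
have GE p : `|p - z| < r -> G p (pi *+ 2) - G p 0 = a p * (pi *+ 2).
  move=> pz; apply: (@cauchy_derivative _ u v p (a p) (b p) r) => //.
  - apply: CR; apply: ballV; rewrite /= distrC (lt_trans pz) //.
    by rewrite /r ltr_pdivrMr // ltr_pMr // ltr1n.
  - move=> s t /andP[s0 sr].
    exists (a (polar p s t)), (b (polar p s t)); apply: CR; apply: Vpolar => //.
    by rewrite sr ltW.
  - by move=> t /andP[t0 _]; exact: dG.
have pi0 : 0 < pi *+ 2 :> R by rewrite mulrn_wgt0 // pi_gt0.
have zz : `|z - z| < r by rewrite subrr normr0.
have cuv t : {for polar z r t, continuous u} /\ {for polar z r t, continuous v}.
  have [|du dv] := CR (polar z r t); first by apply: Vpolar; rewrite ?lexx ?ltW.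
  split; apply: differentiable_continuous; first exact: (@ex_diff _ _ _ _ _ _ _ du).
  exact: (@ex_diff _ _ _ _ _ _ _ dv).
apply/cvgrPdist_lt => e e0.
have er0 : 0 < e * r by rewrite mulr_gt0.
have near1 := radial_near er0 (fun t => (cuv t).1) (fun t => (cuv t).2).
have near2 : \forall p \near z, `|p - z| < r.
  by apply/nbhs_normP; exists r => //= p; rewrite /= distrC.
apply: filterS2 near1 near2 => p near_p pz.
rewrite distrC -(ltr_pM2r pi0) -[X in _ * X < _](ger0_norm (ltW pi0)) -normrM mulrBl.
rewrite -!GE // (_ : _ - _ = (G p (pi *+ 2) - G z (pi *+ 2)) - (G p 0 - G z 0));
  last by ring.
have [||t /[!in_itv]/= t02 ->] := @MVT_segment R (fun t => G p t - G z t)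
  (fun t => radial u v p r t / r - radial u v z r t / r) 0 (pi *+ 2) (ltW pi0).
- move=> t /[!in_itv]/= /andP[/ltW t0 _].
  exact: (is_deriveB (dG p t pz t0) (dG z t zz t0)).
- apply: derivable_within_continuous => t /[!in_itv]/= /andP[t0 _].
  have d1 := dG p t pz t0; have d2 := dG z t zz t0.
  by apply: derivableB; apply: ex_derive.
rewrite subr0 normrM (ger0_norm (ltW pi0)) ltr_pM2r // -mulrBl normrM normfV.
by rewrite (gtr0_norm r0) ltr_pdivrMr //; exact: near_p.
Qed.

Lemma cauchy_riemann_continuous u v (V : set (R * R)) (a b : R * R -> R) z :
  open V -> (forall p, V p -> cauchy_riemann u v p (a p) (b p)) -> V z ->
  {for z, continuous a} /\ {for z, continuous b}.
Proof.
move=> oV CR Vz; split; first exact: (cauchy_riemann_continuous_l oV CR).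
(* Multiplication by [-i] turns [u + i v] into [v - i u] and its derivative into [b - i a], whose
   real part is [b]. *)
apply: (@cauchy_riemann_continuous_l v (- u) V b (- a)) => // p Vp.
have [du dv] := CR p Vp; split.
  by apply: is_diff_eq dv _; apply/funext => h; rewrite fctE mulNr opprK.
apply: is_diff_eq (is_diffN du) _; apply/funext => h.
by rewrite !fctE mulNr opprB addrC.
Qed.

End ContinuousDerivative.

(** * Local surjectivity and differentiability of the inverse *)

Section OpenMap.
Context {R : realType}.
Implicit Types (f X Y : R * R -> R) (p q w : R * R).

(** A linear form that is nonnegative in every direction vanishes, since directions come in opposite
    pairs. *)
Lemma diff_local_min f p v : differentiable f p ->
  (\forall q \near p, f p <= f q) -> 'd f p v = 0.
Proof.
move=> df min.
suff H u : 0 <= 'd f p u.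
  by apply/eqP; rewrite eq_le H -oppr_ge0 -linearN H.
rewrite leNgt; apply/negP => du.
have u0 : 0 < `|u|.
  by rewrite normr_gt0; apply: contraTneq du => ->; rewrite linear0 ltxx.
(* Half the rate of descent per unit length along [u]: the error then undoes at most half of the
   decrease. *)
pose e := - 'd f p u / (2 * `|u|).
have e0 : 0 < e by rewrite divr_gt0 ?oppr_gt0 // mulr_gt0.
have : \forall q \near p,
    `|f q - f p - 'd f p (q - p)| <= e * `|q - p| /\ f p <= f q.
  exact: filterI (differentiable_le df e0) min.
move=> /nbhs_normP[d /= d0 H].
pose t := d / (2 * `|u|).
have t0 : 0 < t by rewrite divr_gt0 // mulr_gt0.
have [|] := H (p + t *: u).
  rewrite /= opprD addrA subrr sub0r normrN normrZ (gtr0_norm t0) /t.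
  by rewrite invfM mulrA mulfVK ?gt_eqF // ltr_pdivrMr // ltr_pMr // ltr1n.
have -> : p + t *: u - p = t *: u by rewrite addrC addKr.
rewrite linearZ normrZ (gtr0_norm t0) /= /GRing.scale /=.
have -> : e * (t * `|u|) = - (t * 'd f p u) / 2.
  by rewrite /e; field; rewrite gt_eqF.
have : t * 'd f p u < 0 by rewrite pmulr_rlt0.
by rewrite ler_norml => + /andP[_]; lra.
Qed.

Definition jacobian2 X Y p : R :=
  'd X p (1, 0) * 'd Y p (0, 1) - 'd X p (0, 1) * 'd Y p (1, 0).

Lemma diffE2 f p (h : R * R) :
  'd f p h = 'd f p (1, 0) * h.1 + 'd f p (0, 1) * h.2.
Proof.
have {1}-> : h = h.1 *: (1, 0) + h.2 *: (0, 1).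
  by case: h => a b; congr (_, _); rewrite /= /GRing.scale /= ?mulr1 ?mulr0; ring.
by rewrite linearD !linearZ /= /GRing.scale /= mulrC (mulrC h.2).
Qed.

(** Cramer's rule. *)
Lemma kernel2 (a b s1 s2 t1 t2 : R) : a * s1 + b * t1 = 0 ->
  a * s2 + b * t2 = 0 -> s1 * t2 - s2 * t1 != 0 -> a = 0 /\ b = 0.
Proof.
move=> e1 e2 d0; split; apply: (mulIf d0); rewrite mul0r.
  transitivity ((a * s1 + b * t1) * t2 - (a * s2 + b * t2) * t1); first by ring.
  by rewrite e1 e2 !mul0r subrr.
transitivity ((a * s2 + b * t2) * s1 - (a * s1 + b * t1) * s2); first by ring.
by rewrite e1 e2 !mul0r subrr.
Qed.

(** At an interior minimum of [psi w], the vector [(X q - w.1, Y q - w.2)] is annihilated by the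
    invertible Jacobian matrix, hence is zero. *)
Lemma local_surjection X Y (U : set (R * R)) p : open U ->
  (forall q, U q -> [/\ differentiable X q, differentiable Y q &
     jacobian2 X Y q != 0]) ->
  {in U &, injective (fun q => (X q, Y q))} -> U p ->
  \forall w \near (X p, Y p), exists2 q, U q & (X q, Y q) = w.
Proof.
move=> oU dx inj Up.
have /nbhs_normP[d /= d0 ballU] : nbhs p U by exact: open_nbhs_nbhs.
pose r := d / 2.
have r0 : 0 < r by rewrite divr_gt0.
have rd : r < d by rewrite /r ltr_pdivrMr // ltr_pMr // ltr1n.
pose K : set (R * R) := `[p.1 - r, p.1 + r] `*` `[p.2 - r, p.2 + r].
have KE q : K q <-> `|p - q| <= r.
  rewrite prod_normE /= ge_max /K /= !in_itv /= !ler_norml.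
  by split=> [[/andP[? ?] /andP[? ?]]|/andP[/andP[? ?] /andP[? ?]]]; lra.
have KU q : K q -> U q.
  by move=> /KE pq; apply: ballU; exact: le_lt_trans rd.
have cK : compact K by apply: compact_setX; exact: segment_compact.
pose psi w q := (X q - w.1) ^+ 2 + (Y q - w.2) ^+ 2.
have dpsi w q : U q -> is_diff q (psi w)
    (fun h => (2 * (X q - w.1)) * 'd X q h + (2 * (Y q - w.2)) * 'd Y q h).
  move=> /dx[/differentiableP d1 /differentiableP d2 _].
  have dsubc g dg (c : R) : is_diff q g dg -> is_diff q (fun x => g x - c) dg.
    move=> dgq; apply: is_diff_eq (is_diff_sub dgq (is_diff_cst c q)) _.
    by apply/funext => h; exact: subr0.
  have e1 := dsubc _ _ w.1 d1; have e2 := dsubc _ _ w.2 d2.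
  apply: is_diff_eq (is_diff_add (is_diff_mul e1 e1) (is_diff_mul e2 e2)) _.
  apply/funext => h.
  have twice (x s : R) : x * s + x * s = 2 * x * s by ring.
  exact: (congr2 +%R (twice _ _) (twice _ _)).
have cpsi w (A : set (R * R)) : A `<=` K -> {within A, continuous (psi w)}.
  move=> AK; apply: continuous_in_subspaceT => q /[!inE] /AK /KU Uq.
  by apply: differentiable_continuous; exact: (@ex_diff _ _ _ _ _ _ _ (dpsi w q Uq)).
(* In the max norm this is the boundary of the square [K]. *)
pose S := K `&` ~` [set q | `|p - q| < r].
have cS : compact S.
  apply: compact_closedI => //; apply: open_closedC.
  by have := ball_open p r; rewrite -ball_normE.
have S0 : S !=set0.
  exists (p.1 + r, p.2); split.
    by apply/KE; rewrite prod_normE /= opprD addrA !subrr sub0r normrN normr0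
      (gtr0_norm r0) ge_max lexx ltW.
  rewrite /= prod_normE /= opprD addrA !subrr sub0r normrN normr0 (gtr0_norm r0).
  by rewrite gt_max ltxx.
have [q0 /[!inE] -[Kq0 q0r] min0] := compact_EVT_min S0 cS
  (cpsi (X p, Y p) S (@subIsetl _ _ _)).
(* The least squared distance from the image of [p] to the image of the boundary; it is positive by
   injectivity. *)
pose m := psi (X p, Y p) q0.
have m0 : 0 < m.
  rewrite lt_neqAle addr_ge0 ?sqr_ge0 // andbT eq_sym paddr_eq0 ?sqr_ge0 //.
  rewrite !sqrf_eq0 !subr_eq0 /=; apply/negP => /andP[/eqP E1 /eqP E2].
  apply: q0r; suff -> : q0 = p by rewrite /= subrr normr0.
  by apply: inj; rewrite ?inE ?E1 ?E2 //; exact: KU.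
have near_w : \forall w \near (X p, Y p), psi w p < m / 4.
  have dm0 : 0 < Num.min 1 (m / 8) by rewrite lt_min ltr01 divr_gt0.
  apply/nbhs_normP; exists (Num.min 1 (m / 8)) => // w.
  rewrite /= prod_normE /= gt_max !lt_min => /andP[/andP[a1 am] /andP[b1 bm]].
  have sqr_lt (x : R) : `|x| < 1 -> `|x| < m / 8 -> x ^+ 2 < m / 8.
    move=> x1 xm; rewrite -real_normK ?num_real //; apply: le_lt_trans xm.
    by rewrite expr2 ler_piMl // ltW.
  rewrite (_ : m / 4 = m / 8 + m / 8); last by field.
  by rewrite ltrD ?sqr_lt.
apply: filterS near_w => w wm.
have Kp : K p by apply/KE; rewrite subrr normr0 ltW.
have [q1 /[!inE] Kq1 min1] := compact_EVT_min (ex_intro _ p Kp) cK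
  (cpsi w K (@subset_refl _ _)).
have Uq1 := KU _ Kq1.
have q1r : `|p - q1| < r.
  apply: contrapT => nq1.
  have := min0 q1; have := min1 p; rewrite !inE -/m => /(_ Kp) le1.
  move=> /(_ (conj Kq1 nq1)); rewrite leNgt => /negP; apply.
  (* A minimizer [q1] on the boundary would give [m <= 2 psi w q1 + 2 psi w p <= 4 psi w p < m];
     hence the threshold [m / 4]. *)
  apply: (@le_lt_trans _ _ (2 * psi w q1 + 2 * psi w p)).
    rewrite /psi /=; have sq (x y z : R) : (x - z) ^+ 2 <=
        2 * (x - y) ^+ 2 + 2 * (z - y) ^+ 2.
      rewrite -subr_ge0 (_ : _ - _ = (x + z - 2 * y) ^+ 2) ?sqr_ge0 //; ring.
    have := sq (X q1) w.1 (X p); have := sq (Y q1) w.2 (Y p).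
    by clear; lra.
  by move: le1 wm; clear; lra.
have min_near : \forall q \near q1, psi w q1 <= psi w q.
  have near_r : \forall q \near q1, `|p - q| < r.
    have := @ball_open_nbhs R _ p r r0; rewrite -ball_normE => -[oB _].
    exact: (open_nbhs_nbhs (conj oB q1r)).
  by apply: filterS near_r => q /ltW /KE Kq; apply: min1; rewrite inE.
exists q1 => //.
have [dX dY jq1] := dx q1 Uq1.
have dpsi1 := dpsi w q1 Uq1.
have crit v : (X q1 - w.1) * 'd X q1 v + (Y q1 - w.2) * 'd Y q1 v = 0.
  have := diff_local_min v (@ex_diff _ _ _ _ _ _ _ dpsi1) min_near.
  have -> : 'd (psi w) q1 v = _ := congr1 (@^~ v) (@diff_val _ _ _ _ _ _ _ dpsi1).
  rewrite -!mulrA -mulrDr => /eqP.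
  by rewrite mulf_eq0 pnatr_eq0 /= => /eqP.
have [/eqP + /eqP] := kernel2 (crit (1, 0)) (crit (0, 1)) jq1.
by rewrite !subr_eq0 => /eqP -> /eqP ->; rewrite -surjective_pairing.
Qed.

End OpenMap.

Section InverseDiff.
Context {R : realType}.
Implicit Types (f X Y : R * R -> R) (p q w : R * R).

(** A converse of [differentiable_le] for an explicit candidate, which is presented as the
    differential at [0] of a linear map in order to match [diff_unique]. *)
Lemma is_diff_le f p (a b : R) :
  (forall e, 0 < e -> \forall q \near p,
    `|f q - f p - (a * (q.1 - p.1) + b * (q.2 - p.2))| <= e * `|q - p|) ->
  is_diff p f (fun h => a * h.1 + b * h.2).
Proof.
move=> H; pose l (h : R * R) := a * h.1 + b * h.2.
have dl : is_diff (0 : R * R) l l.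
  have scl (c : R) g dg : is_diff (0 : R * R) g dg ->
      is_diff (0 : R * R) (fun h => c * g h) (fun h => c * dg h).
    by move=> dg0; exact: (@is_diffZ _ _ _ g dg c 0).
  exact: (is_diff_add (scl a _ _ (is_diff_fst 0)) (scl b _ _ (is_diff_snd 0))).
have dlE := @diff_val _ _ _ _ _ _ _ dl.
have cl : continuous ('d l (0 : R * R)).
  by move=> h; apply: diff_continuous; exact: (@ex_diff _ _ _ _ _ _ _ dl).
have fE : f \o shift p = cst (f p) + 'd l (0 : R * R) +o_ (0 : R * R) id.
  apply/eqaddoP => e e0; have := H e e0.
  rewrite (near_shift 0 p) dlE; apply: filterS => h /=.
  by rewrite !subr0 !addrK -[X in `|X| <= _ -> _]addrA -opprD.
have E := diff_unique cl fE.
have df : differentiable f p by apply/diff_locallyP; rewrite E; exact: (conj cl fE).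
exact: DiffDef df (etrans E dlE).
Qed.

(** Cramer's rule in quantitative form: an invertible matrix bounds [h] by its image. *)
Lemma norm_mul_det (x1 x2 y1 y2 s t : R) (h : R * R) :
  s = x1 * h.1 + x2 * h.2 -> t = y1 * h.1 + y2 * h.2 ->
  `|h| * `|x1 * y2 - x2 * y1| <= (`|x1| + `|x2| + `|y1| + `|y2|) *
    Num.max `|s| `|t|.
Proof.
move=> sE tE.
pose M := Num.max `|s| `|t|; rewrite -/M.
have sM : `|s| <= M by rewrite /M le_max lexx.
have tM : `|t| <= M by rewrite /M le_max lexx orbT.
have M0 : 0 <= M by exact: le_trans tM.
have bound (c d : R) : `|c| + `|d| <= `|x1| + `|x2| + `|y1| + `|y2| ->
    `|c * s - d * t| <= (`|x1| + `|x2| + `|y1| + `|y2|) * M.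
  move=> cd; apply: le_trans (ler_normB _ _) _; rewrite !normrM.
  apply: le_trans (ler_wpM2r M0 cd); rewrite mulrDl.
  by apply: lerD; rewrite ler_wpM2l.
rewrite prod_normE /= maxr_pMl // ge_max -!normrM.
rewrite (_ : h.1 * _ = y2 * s - x2 * t); last by rewrite sE tE; ring.
rewrite (_ : h.2 * _ = - y1 * s - - x1 * t); last by rewrite sE tE; ring.
have ? := normr_ge0 x1; have ? := normr_ge0 x2.
have ? := normr_ge0 y1; have ? := normr_ge0 y2.
by apply/andP; split; apply: bound; rewrite ?normrN; lra.
Qed.

(** [norm_mul_det] makes the displacement of [Z] at most [2 * C] times that of [w], so the
    first-order errors of [f], [X] and [Y] at [p] remain first-order errors in [w]. The differential
    of [Z] itself is never computed. *)
Lemma diff_factor_inverse f X Y (Z : R * R -> R * R) p (a b : R) :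
  differentiable f p -> differentiable X p -> differentiable Y p ->
  jacobian2 X Y p != 0 ->
  (forall h, 'd f p h = a * 'd X p h + b * 'd Y p h) ->
  Z (X p, Y p) = p -> {for (X p, Y p), continuous Z} ->
  (\forall w \near (X p, Y p), (X (Z w), Y (Z w)) = w) ->
  is_diff (X p, Y p) (f \o Z) (fun h => a * h.1 + b * h.2).
Proof.
move=> df dX dY j0 fE Zp cZ ZK; apply: is_diff_le => e e0.
pose J := `|jacobian2 X Y p|.
have J0 : 0 < J by rewrite normr_gt0.
pose C := (`|'d X p (1, 0)| + `|'d X p (0, 1)| + `|'d Y p (1, 0)| +
  `|'d Y p (0, 1)|) / J.
have C0 : 0 <= C by apply: divr_ge0; [rewrite !addr_ge0|exact: ltW].
(* The first bound lets [C * k * |h| <= |h| / 2] be absorbed in the estimate of [h]; the second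
   brings the total error below [e]. *)
pose k := Num.min (2 * C + 1)^-1 (e / ((1 + `|a| + `|b|) * (2 * C + 1))).
have C1 : 0 < 2 * C + 1 by rewrite ltr_wpDl // mulr_ge0.
have ab1 : 0 < 1 + `|a| + `|b| by rewrite !ltr_wpDr.
have k0 : 0 < k by rewrite lt_min invr_gt0 C1 divr_gt0 // mulr_gt0.
have kC : 2 * C * k <= 1.
  apply: (@le_trans _ _ (2 * C * (2 * C + 1)^-1)).
    by apply: ler_wpM2l; [rewrite mulr_ge0|rewrite /k ge_min lexx].
  by rewrite ler_pdivrMr // mul1r lerDl.
have ke : (1 + `|a| + `|b|) * k * (2 * C) <= e.
  apply: (@le_trans _ _ ((1 + `|a| + `|b|) *
      (e / ((1 + `|a| + `|b|) * (2 * C + 1))) * (2 * C + 1))).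
    apply: ler_pM.
    - by apply: mulr_ge0; exact: ltW.
    - by rewrite mulr_ge0.
    - by rewrite ler_pM2l // /k ge_min lexx orbT.
    - by rewrite lerDl.
  by rewrite -mulrA mulrC -mulrA (mulrC _ (1 + _ + _)) divfK // mulf_neq0 ?gt_eqF.
have lower h : `|h| <= C * Num.max `|'d X p h| `|'d Y p h|.
  rewrite mulrAC ler_pdivlMr //.
  exact: norm_mul_det (diffE2 X p h) (diffE2 Y p h).
have cZp : Z w @[w --> (X p, Y p)] --> p by rewrite -[X in _ --> X]Zp; exact: cZ.
have H1 := cZp _ (differentiable_le df k0).
have H2 := cZp _ (differentiable_le dX k0).
have H3 := cZp _ (differentiable_le dY k0).
apply: filterS2 ZK (filterI H1 (filterI H2 H3)) => w wE [fle [Xle Yle]].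
move: fle Xle Yle => /=.
have -> : X (Z w) = w.1 := congr1 fst wE.
have -> : Y (Z w) = w.2 := congr1 snd wE.
set h := Z w - p; rewrite (fE h) Zp.
have := lower h; move: ('d X p h) ('d Y p h) => s t hle.
move: (f (Z w) - f p) => df' fle Xle Yle.
set N := `|w - (X p, Y p)|.
have XN : `|w.1 - X p| <= N by rewrite /N prod_normE le_max lexx.
have YN : `|w.2 - Y p| <= N by rewrite /N prod_normE le_max lexx orbT.
have tri (x y : R) : `|x| <= N -> `|x - y| <= k * `|h| -> `|y| <= N + k * `|h|.
  move=> xN xy; rewrite -[y](subKr x); apply: le_trans (ler_normB _ _) _.
  exact: lerD.
have hN : `|h| <= 2 * C * N.
  have : Num.max `|s| `|t| <= N + k * `|h|.
    by rewrite ge_max (tri _ _ XN Xle) (tri _ _ YN Yle).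
  move/(ler_wpM2l C0)/(le_trans hle).
  have := ler_wpM2r (normr_ge0 h) kC.
  by clear; lra.
apply: (@le_trans _ _ ((1 + `|a| + `|b|) * k * `|h|)); last first.
  apply: (@le_trans _ _ ((1 + `|a| + `|b|) * k * (2 * C * N))).
    by apply: ler_wpM2l => //; apply: mulr_ge0; exact: ltW.
  by rewrite mulrA; apply: ler_wpM2r; [exact: normr_ge0|exact: ke].
rewrite (_ : _ - _ = (df' - (a * s + b * t)) - (a * (w.1 - X p - s) +
  b * (w.2 - Y p - t))); last by ring.
apply: le_trans (ler_normB _ _) _.
have -> : (1 + `|a| + `|b|) * k * `|h| =
    k * `|h| + (`|a| * (k * `|h|) + `|b| * (k * `|h|)) by ring.
apply: (lerD fle); apply: le_trans (ler_normD _ _) _; rewrite !normrM.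
by apply: lerD; rewrite ler_wpM2l.
Qed.

End InverseDiff.

(** * The complex plane as [R * R] *)

Section ComplexPlane.
Context {R : realType}.
Implicit Types (z w c : R[i]) (p q : R * R) (G : R[i] -> R[i]).

Definition complex_of p : R[i] := p.1 +i* p.2.
Definition plane_of z : R * R := (complex.Re z, complex.Im z).

Lemma complex_ofK : cancel complex_of plane_of. Proof. by case. Qed.
Lemma plane_ofK : cancel plane_of complex_of. Proof. by case. Qed.

Lemma complex_ofB p q : complex_of (p - q) = complex_of p - complex_of q.
Proof. by []. Qed.

Lemma plane_ofB z w : plane_of (z - w) = plane_of z - plane_of w.
Proof. by case: z w => [a b] []. Qed.

Lemma norm_plane_of z : `|plane_of z|%:C <= `|z|.
Proof.
rewrite normc_def lecR prod_normE ge_max /=.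
have sqrt_ge (x y : R) : `|x| <= Num.sqrt (x ^+ 2 + y ^+ 2).
  by rewrite -sqrtr_sqr ler_sqrt ?lerDl ?addr_ge0 ?sqr_ge0.
by rewrite sqrt_ge addrC sqrt_ge.
Qed.

(** The plane carries the max norm, so the sharp factor is the square root of 2; the cruder 2
    suffices for limits. *)
Lemma norm_complex_of p : `|complex_of p| <= (2 * `|p|)%:C.
Proof.
have n0 := normr_ge0 p.
have sqr_le (x : R) : `|x| <= `|p| -> x ^+ 2 <= `|p| ^+ 2.
  by move=> xp; rewrite -real_normK ?num_real // ler_pXn2r ?nnegrE.
have p1 : `|p.1| <= `|p| by rewrite prod_normE le_max lexx.
have p2 : `|p.2| <= `|p| by rewrite prod_normE le_max lexx orbT.
rewrite normc_def lecR /= -[leRHS]ger0_norm ?mulr_ge0 // -sqrtr_sqr.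
rewrite ler_sqrt ?sqr_ge0 //; have := sqr_le _ p1; have := sqr_le _ p2.
have := sqr_ge0 `|p|; rewrite exprMn; lra.
Qed.

(** The order on [R[i]] compares only numbers with equal imaginary parts. This converts the complex
    tolerances of [R[i]^o] into real ones. *)
Lemma ltc0P (e : R[i]) : 0 < e -> exists2 r : R, 0 < r & e = r%:C.
Proof.
by case: e => a b; rewrite ltcE /= => /andP[/eqP -> a0]; exists a.
Qed.

Lemma continuous_complex_of : continuous (complex_of : R * R -> R[i]^o).
Proof.
move=> p; apply/cvgrPdist_lt => e /ltc0P[r r0 ->].
have : \forall q \near p, `|p - q| < r / 2.
  by apply/nbhs_normP; exists (r / 2) => //=; rewrite divr_gt0.
apply: filterS => q; rewrite ltr_pdivlMr // mulrC => pq.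
by rewrite -complex_ofB (le_lt_trans (norm_complex_of _)) // ltcR.
Qed.

Lemma continuous_plane_of : continuous (plane_of : R[i]^o -> R * R).
Proof.
move=> z A /nbhs_ballP[e /= e0 eA]; apply/nbhs_ballP.
exists e%:C; first by rewrite /= ltcR.
move=> w; rewrite -ball_normE /= => zw; apply: eA.
rewrite -ball_normE /= -plane_ofB -ltcR.
exact: le_lt_trans (norm_plane_of _) zw.
Qed.

Lemma near_plane z (P : R[i] -> Prop) :
  (\forall w \near (z : R[i]^o), P w) <->
  (\forall q \near plane_of z, P (complex_of q)).
Proof.
split=> H.
  have := @continuous_complex_of (plane_of z); rewrite /continuous_at plane_ofK.
  by apply.
rewrite (_ : P = fun w => P (complex_of (plane_of w))).
  exact: (@continuous_plane_of z _ H).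
by apply/funext => w; rewrite plane_ofK.
Qed.

Lemma plane_of_affine z g g' c p :
  plane_of (g - g' - (complex_of p - z) * c) =
  (complex.Re g - complex.Re g' - (complex.Re c * (p.1 - complex.Re z) -
     complex.Im c * (p.2 - complex.Im z)),
   complex.Im g - complex.Im g' - (complex.Im c * (p.1 - complex.Re z) +
     complex.Re c * (p.2 - complex.Im z))).
Proof.
by case: z g g' c => [z1 z2] [g1 g2] [h1 h2] [a b]; congr (_, _); rewrite /=; ring.
Qed.

(** A complex linear differential is multiplication by its value [c] at [1]. *)
Lemma derivable_cauchy_riemann (G : R[i]^o -> R[i]^o) (z : R[i]^o) :
  derivable G z 1 ->
  exists c, cauchy_riemann (fun p => complex.Re (G (complex_of p)))
    (fun p => complex.Im (G (complex_of p))) (plane_of z)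
    (complex.Re c) (complex.Im c).
Proof.
move=> /derivable1_diffP dG; pose c : R[i] := 'd G z 1; exists c.
have dGE h : 'd G z h = h * c.
  have -> : 'd G z h = 'd G z (h *: (1 : R[i]^o)).
    by congr ('d G z _); exact: esym (mulr1 h).
  by rewrite linearZ.
have approx e : 0 < e -> \forall q \near plane_of z,
    `|plane_of (G (complex_of q) - G z - (complex_of q - z) * c)| <=
    e * `|q - plane_of z|.
  (* Halving [e] compensates for the factor 2 of [norm_complex_of]. *)
  move=> e0; have e20 : 0 < (e / 2)%:C :> R[i] by rewrite ltcR divr_gt0.
  have /near_plane := differentiable_le dG e20; apply: filterS => q.
  rewrite dGE => le; rewrite -lecR; apply: le_trans (norm_plane_of _) _.
  apply: le_trans le _.
  have -> : complex_of q - z = complex_of (q - plane_of z).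
    by rewrite complex_ofB plane_ofK.
  apply: le_trans (ler_wpM2l (ltW e20) (norm_complex_of _)) _.
  by rewrite -rmorphM /= lecR mulrA divfK.
split.
  apply: (@is_diff_eq _ _ _ _ (fun h => complex.Re c * h.1 + - complex.Im c * h.2)).
    apply: is_diff_le => e /approx; apply: filterS => q.
    rewrite plane_of_affine prod_normE ge_max plane_ofK /= => /andP[+ _].
    by rewrite mulNr.
  by apply/funext => h; rewrite mulNr.
apply: is_diff_le => e /approx; apply: filterS => q.
by rewrite plane_of_affine prod_normE ge_max plane_ofK /= => /andP[_ +].
Qed.

Lemma cauchy_riemann_derivable (G : R[i]^o -> R[i]^o) (z : R[i]^o) c :
  cauchy_riemann (fun p => complex.Re (G (complex_of p)))
    (fun p => complex.Im (G (complex_of p))) (plane_of z)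
    (complex.Re c) (complex.Im c) ->
  derivable G z 1.
Proof.
move=> CR; apply/cvg_ex; exists (c : R[i]^o).
apply/cvgrPdist_le => e' /ltc0P[e e0 ->].
have : \forall w \near z, `|G w - G z - (w - z) * c| <= e%:C * `|w - z|.
  apply/near_plane; have e20 : 0 < e / 2 by rewrite divr_gt0.
  apply: filterS (cauchy_riemann_near CR e20) => q [le1 le2].
  rewrite -[X in `|X|]plane_ofK; apply: le_trans (norm_complex_of _) _.
  apply: (@le_trans _ _ (e * `|q - plane_of z|)%:C); last first.
    rewrite rmorphM /=; apply: ler_wpM2l; first by rewrite ler0c ltW.
    rewrite -[q in `|q - _|]complex_ofK -plane_ofB; exact: norm_plane_of.
  rewrite lecR plane_of_affine prod_normE /= mulrC -ler_pdivlMr // mulrAC.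
  by rewrite ge_max; move: le1 le2; rewrite plane_ofK => -> ->.
rewrite (near_shift 0 z) /= => H.
rewrite /dnbhs near_withinE.
apply: filterS H => h /=; rewrite subr0 addrK => H h0.
have -> : h *: (1 : R[i]^o) = h by exact: mulr1.
rewrite -[_ *: _]/(h^-1 * (G (h + z) - G z)).
have -> : c - h^-1 * (G (h + z) - G z) = - (h^-1 * (G (h + z) - G z - h * c)).
  by rewrite [X in _ = - X]mulrBr mulKf // opprB.
by rewrite normrN normrM normfV mulrC ler_pdivrMr ?normr_gt0.
Qed.

End ComplexPlane.

(** * The coordinate [xi] *)

Section C1Closure.
Context {R : realType}.
Context (U : set (R * R)) (hU : open U).
Implicit Types (u w : R * R -> R) (f g : R * R -> R[i]).

(** [u - w] is constant on the open set [U], hence [C1] there whatever its values outside. *)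
Lemma eq_C1 u w : (forall p, U p -> u p = w p) -> C1 U u -> C1 U w.
Proof.
move=> uw Cu.
have C0 : C1 U (fun p => u p - w p).
  by apply: (@C1_near_cst _ _ hU _ 0) => p Up; rewrite uw // subrr.
have -> : w = (fun p => u p - (u p - w p)) by apply/funext => p; rewrite subKr.
exact: C1B.
Qed.

Lemma C1_fst : C1 U fst.
Proof.
split=> [p _|v p _]; first exact: (@ex_diff _ _ _ _ _ _ _ (is_diff_fst p)).
have -> : 'D_v (fst : R * R -> R) = cst v.1.
  apply/funext => q; have dq := is_diff_fst q.
  by rewrite deriveE ?(@diff_val _ _ _ _ _ _ _ dq) //;
     exact: (@ex_diff _ _ _ _ _ _ _ dq).
exact: cvg_cst.
Qed.

Lemma C1_snd : C1 U snd.
Proof.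
split=> [p _|v p _]; first exact: (@ex_diff _ _ _ _ _ _ _ (is_diff_snd p)).
have -> : 'D_v (snd : R * R -> R) = cst v.2.
  apply/funext => q; have dq := is_diff_snd q.
  by rewrite deriveE ?(@diff_val _ _ _ _ _ _ _ dq) //;
     exact: (@ex_diff _ _ _ _ _ _ _ dq).
exact: cvg_cst.
Qed.

Lemma near_eq_continuous (S T : topologicalType) (k l : S -> T) x :
  (\forall y \near x, k y = l y) -> {for x, continuous k} ->
  {for x, continuous l}.
Proof.
move=> kl; rewrite /prop_for /continuous_at (nbhs_singleton kl).
by apply: cvg_trans; exact: near_eq_cvg.
Qed.

Lemma C1_sqrt u : C1 U u -> (forall p, U p -> 0 < u p) ->
  C1 U (fun p => Num.sqrt (u p)).
Proof.
move=> [du cu] u0.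
have ds p : U p -> is_diff p (fun p => Num.sqrt (u p))
    (fun h => 'd u p h * (2 * Num.sqrt (u p))^-1).
  move=> Up; apply: is_diff_derive_comp; first exact/differentiableP/du.
  exact/is_derive1_sqrt/u0.
split=> [p Up|v p Up]; first exact: (@ex_diff _ _ _ _ _ _ _ (ds p Up)).
have E q : U q -> 'D_v (fun p => Num.sqrt (u p)) q =
    'D_v u q * (2 * Num.sqrt (u q))^-1.
  move=> Uq; have dq := ds q Uq.
  rewrite deriveE; last exact: (@ex_diff _ _ _ _ _ _ _ dq).
  by rewrite (@diff_val _ _ _ _ _ _ _ dq) deriveE //; exact: du.
apply: (@near_eq_continuous _ _ (fun q => 'D_v u q * (2 * Num.sqrt (u q))^-1)).
  have : nbhs p U by exact: open_nbhs_nbhs.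
  by apply: filterS => q /E ->.
have cs : {for p, continuous (fun p => Num.sqrt (u p))}.
  exact/differentiable_continuous/(@ex_diff _ _ _ _ _ _ _ (ds p Up)).
apply: cvgM; first exact: cu.
apply: cvgV; first by rewrite mulf_neq0 // gt_eqF // sqrtr_gt0 u0.
by apply: cvgM; [exact: cvg_cst|exact: cs].
Qed.

End C1Closure.

Section DeriveComplex.
Context {R : realType}.
Implicit Types (f g lam : R * R -> R[i]) (p v : R * R).

Lemma derive_complex_near_eq f g v p : (\forall q \near p, f q = g q) ->
  derive_complex v f p = derive_complex v g p.
Proof.
move=> fg; rewrite /derive_complex; congr (_ +i* _); apply: near_eq_derive;
  by apply: filterS fg => q ->.
Qed.

Lemma derive_complexE f v p :
  differentiable (fun q => complex.Re (f q)) p ->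
  differentiable (fun q => complex.Im (f q)) p ->
  derive_complex v f p = v.1%:C * dx f p + v.2%:C * dy f p.
Proof.
move=> df1 df2; rewrite /dx /dy /derive_complex !deriveE //.
have comb (a1 b1 a2 b2 s t : R) : (a1 * s + b1 * t) +i* (a2 * s + b2 * t) =
    s%:C * (a1 +i* a2) + t%:C * (b1 +i* b2).
  by simpc; congr (_ +i* _); ring.
exact: etrans (congr2 (@Complex R) (diffE2 _ p v) (diffE2 _ p v)) (comb _ _ _ _ _ _).
Qed.

Lemma derive_complexJ f v p :
  derivable (fun q => complex.Im (f q)) p v ->
  derive_complex v (fun q => (f q)^*) p = (derive_complex v f p)^*.
Proof.
move=> df; rewrite /derive_complex /=.
have -> : (fun q => complex.Re (f q)^*) = (fun q => complex.Re (f q)).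
  by apply/funext => q; case: (f q).
have -> : (fun q => complex.Im (f q)^*) = - (fun q => complex.Im (f q)).
  by apply/funext => q; rewrite fctE; case: (f q).
by rewrite deriveN.
Qed.

Lemma Re_half (z : R[i]) : complex.Re (z / 2) = complex.Re z / 2.
Proof.
have -> : (2 : R[i])^-1 = (2^-1)%:C by rewrite fmorphV rmorph_nat.
by case: z => a b; simpc.
Qed.

Lemma Im_half (z : R[i]) : complex.Im (z / 2) = complex.Im z / 2.
Proof.
have -> : (2 : R[i])^-1 = (2^-1)%:C by rewrite fmorphV rmorph_nat.
by case: z => a b; simpc.
Qed.

End DeriveComplex.

(** * Rigidity, [Phi] and the Jacobian of [xi] *)

Section Rigid.
Context {R : realType}.
Context (U : set (R * R)) (hU : open U) (lam : R * R -> R[i])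
  (Clam : C1_complex U lam).
Implicit Types (f : R * R -> R[i]) (p v : R * R).

Lemma C1_complex_derive_complexE f v p : C1_complex U f -> U p ->
  derive_complex v f p = v.1%:C * dx f p + v.2%:C * dy f p.
Proof.
by move=> [[d1 _] [d2 _]] Up; apply: derive_complexE; [exact: d1|exact: d2].
Qed.

Lemma C1_real_complex (u : R * R -> R) : C1 U u -> C1_complex U (fun p => (u p)%:C).
Proof. by move=> Cu; split; [exact: Cu|exact: (@C1_near_cst _ _ hU _ 0)]. Qed.

Lemma derive_real_complex (u : R * R -> R) v p :
  derive_complex v (fun q => (u q)%:C) p = ('D_v u p)%:C.
Proof. by rewrite /derive_complex /= derive_cst. Qed.

Lemma xiE : xi lam = (fun p => (p.2)%:C) - lam * (fun p => (p.1)%:C).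
Proof. by []. Qed.

Lemma C1_xi : C1_complex U (xi lam).
Proof.
rewrite xiE; apply: (C1_complexB hU (C1_real_complex (C1_snd U))).
exact: (C1_complexM hU Clam (C1_real_complex (C1_fst U))).
Qed.

Lemma derive_xi v p : U p -> derive_complex v (xi lam) p =
  v.2%:C - (lam p * v.1%:C + p.1%:C * derive_complex v lam p).
Proof.
move=> Up; have C2 := C1_real_complex (C1_snd U).
have C1 := C1_real_complex (C1_fst U).
rewrite xiE (derive_complexB v C2 (C1_complexM hU Clam C1) Up).
rewrite (derive_complexM hU v Clam C1 Up) !derive_real_complex.
have d1 := is_diff_fst p; have d2 := is_diff_snd p.
have e1 := @ex_diff _ _ _ _ _ _ _ d1; have e2 := @ex_diff _ _ _ _ _ _ _ d2.
by rewrite !deriveE // (@diff_val _ _ _ _ _ _ _ d1) (@diff_val _ _ _ _ _ _ _ d2).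
Qed.

(** By the product rule, [xi_x + lam xi_y = - x (lam_x + lam lam_y)]: the terms [- lam] and [+ lam]
    cancel. *)
Lemma xi_rigid p : dx lam p + lam p * dy lam p = 0 -> U p ->
  dx (xi lam) p + lam p * dy (xi lam) p = 0.
Proof.
move=> E Up; rewrite /dx /dy !derive_xi //=.
rewrite -[RHS](mulr0 (- (p.1)%:C)) -[X in _ = _ * X]E /dx /dy.
by rewrite rmorph0 rmorph1; ring.
Qed.

Lemma rigid_derive f v p : C1_complex U f -> U p ->
  dx f p + lam p * dy f p = 0 ->
  derive_complex v f p = dy f p * (v.2%:C - lam p * v.1%:C).
Proof.
move=> Cf Up /eqP; rewrite addr_eq0 => /eqP E.
by rewrite (C1_complex_derive_complexE v Cf Up) E; ring.
Qed.

Lemma Phi_xi p : U p -> dx lam p + lam p * dy lam p = 0 ->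
  Phi lam p = (lam p - (lam p)^*) * (dy (xi lam) p)^*.
Proof.
move=> Up E; have [_ [dxi _]] := C1_xi.
have D v : derivable (fun q => complex.Im (xi lam q)) p v.
  exact/diff_derivable/dxi.
rewrite /Phi {1}/dx {1}/dy !derive_complexJ //.
have /eqP := xi_rigid E Up; rewrite addr_eq0 => /eqP.
rewrite -/(dx (xi lam) p) -/(dy (xi lam) p) => ->.
by rewrite rmorphN rmorphM mulrBl addrC.
Qed.

Lemma jacobian_xi p : U p -> dx lam p + lam p * dy lam p = 0 ->
  0 < complex.Im (lam p) -> Phi lam p != 0 ->
  jacobian2 (fun q => complex.Re (xi lam q)) (fun q => complex.Im (xi lam q)) p
    != 0.
Proof.
move=> Up E l0; rewrite (Phi_xi Up E) mulf_eq0 negb_or => /andP[_].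
rewrite conjc_eq0 => c0; have [[d1 _] [d2 _]] := C1_xi.
have dX := d1 p Up; have dY := d2 p Up.
have := xi_rigid E Up; rewrite /jacobian2 -!deriveE //.
move: c0; rewrite /dx /dy /derive_complex.
move: ('D__ _ _) ('D__ _ _) ('D__ _ _) ('D__ _ _) => dx2 dx1 dy2 dy1.
case: (lam p) l0 => l1 l2 /= l0; rewrite !eq_complex /= => c0.
simpc => /eqP; rewrite eq_complex /= => /andP[/eqP E1 /eqP E2].
(* The real and imaginary parts of [xi_x = - lam xi_y] eliminate the derivatives in [x]. *)
have -> : dx1 = l2 * dy2 - l1 * dy1 by move: E1; clear; lra.
have -> : dx2 = - (l1 * dy2 + l2 * dy1) by move: E2; clear; lra.
rewrite (_ : _ - _ = l2 * (dy1 ^+ 2 + dy2 ^+ 2)); last by ring.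
apply: mulf_neq0; first by rewrite gt_eqF.
by rewrite paddr_eq0 ?sqr_ge0 // !sqrf_eq0.
Qed.

End Rigid.

(** * Regularity of the spectral parameter *)

Section Spectral.
Context {R : realType}.
Context (U : set (R * R)) (hU : open U) (alpha beta : R * R -> R)
  (ell : elliptic_structure U alpha beta).
Let lam := spectral alpha beta.

Lemma C1_cst (c : R) : C1 U (fun _ => c).
Proof. exact: (@C1_near_cst _ _ hU _ c). Qed.

Lemma spectral_C1 : C1_complex U lam.
Proof.
have [Ca Cb D0] := ell; split.
  have -> : (fun p => complex.Re (lam p)) = (fun p => - 2^-1 * beta p).
    by apply/funext => p; rewrite /lam /spectral Re_half /=; ring.
  exact: (C1M hU (C1_cst _) Cb).
have -> : (fun p => complex.Im (lam p)) =
    (fun p => 2^-1 * Num.sqrt (Delta alpha beta p)).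
  by apply/funext => p; rewrite /lam /spectral Im_half /= mulrC.
have CD : C1 U (Delta alpha beta).
  exact: (C1B hU (C1M hU (C1_cst 4) Ca) (C1M hU Cb Cb)).
exact: (C1M hU (C1_cst _) (C1_sqrt hU CD D0)).
Qed.

Lemma Im_spectral_gt0 p : U p -> 0 < complex.Im (lam p).
Proof.
move=> Up; rewrite /lam /spectral Im_half divr_gt0 // sqrtr_gt0.
by have [_ _] := ell; apply.
Qed.

End Spectral.

(** * Holomorphy under an injective [C^1] change of variable *)

Section ChangeOfVariable.
Context {R : realType} (U : set (R * R)) (hU : open U) (zeta : R * R -> R[i]).
Context (Czeta : C1_complex U zeta).
Context (jac : forall p, U p -> jacobian2 (fun q => complex.Re (zeta q))
  (fun q => complex.Im (zeta q)) p != 0).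
Context (inj : set_inj U zeta).
Implicit Types (p q v : R * R).
Let X p := complex.Re (zeta p).
Let Y p := complex.Im (zeta p).

(** Taking [W = U] gives openness of the image; smaller [W] give continuity of the inverse. *)
Lemma zeta_local_surjection (W : set (R * R)) p : open W -> W `<=` U -> W p ->
  \forall w \near (X p, Y p), exists2 q, W q & (X q, Y q) = w.
Proof.
move=> oW WU Wp; have [[dX _] [dY _]] := Czeta.
apply: local_surjection oW _ _ Wp.
  by move=> q /WU Uq; split; [exact: dX|exact: dY|exact: jac].
move=> q1 q2 /[!inE] /WU U1 /WU U2 E; apply: inj; rewrite ?inE //.
rewrite -(plane_ofK (zeta q1)) -(plane_ofK (zeta q2)).
exact: (congr1 complex_of E).
Qed.

Lemma open_image_zeta : open (zeta @` U : set R[i]^o).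
Proof.
rewrite openE => _ [p Up <-]; apply/near_plane.
apply: filterS (zeta_local_surjection hU (@subset_refl _ U) Up).
by move=> w [q Uq <-]; exists q => //; rewrite -[LHS]plane_ofK.
Qed.

(** By the chain rule the differential of [G \o zeta] is that of [zeta] times [G'];
    [cauchy_riemann_continuous] supplies the continuity of [G'] needed for [C^1]. *)
Lemma holomorphic_comp_C1 (G : R[i]^o -> R[i]^o) :
  (forall z, (zeta @` U) z -> derivable G z 1) ->
  C1_complex U (G \o zeta) /\ forall p, U p -> exists c, forall v,
    derive_complex v (G \o zeta) p = c * derive_complex v zeta p.
Proof.
move=> dG; have [[dX cX] [dY cY]] := Czeta.
pose V : set (R * R) := complex_of @^-1` (zeta @` U).
have oV : open V.
  by apply: open_comp open_image_zeta => q _; exact: continuous_complex_of.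
pose u q := complex.Re (G (complex_of q)); pose w q := complex.Im (G (complex_of q)).
(* [c] is [G'] read on the plane, with the arbitrary value [0] off the image. *)
have /choice[c cP] q : exists c, V q ->
    cauchy_riemann u w q (complex.Re c) (complex.Im c).
  have [Vq|nVq] := pselect (V q); last by exists 0.
  have [c] := derivable_cauchy_riemann (dG _ Vq).
  by rewrite complex_ofK => CR; exists c.
have Vzeta p : U p -> V (X p, Y p).
  by move=> Up; exists p => //; rewrite -[LHS]plane_ofK.
have cc p : U p -> {for (X p, Y p), continuous (fun q => complex.Re (c q))} /\
    {for (X p, Y p), continuous (fun q => complex.Im (c q))}.
  by move=> /Vzeta Vp; exact: (cauchy_riemann_continuous oV cP Vp).
have du p : U p -> is_diff p (fun q => u (X q, Y q))
    (fun h => complex.Re (c (X p, Y p)) * 'd X p h -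
              complex.Im (c (X p, Y p)) * 'd Y p h).
  move=> Up; have [CRu _] := cP _ (Vzeta p Up).
  exact: is_diff_pair_comp (differentiableP (dX p Up)) (differentiableP (dY p Up)) CRu.
have dw p : U p -> is_diff p (fun q => w (X q, Y q))
    (fun h => complex.Im (c (X p, Y p)) * 'd X p h +
              complex.Re (c (X p, Y p)) * 'd Y p h).
  move=> Up; have [_ CRw] := cP _ (Vzeta p Up).
  exact: is_diff_pair_comp (differentiableP (dX p Up)) (differentiableP (dY p Up)) CRw.
have Du v p : U p -> 'D_v (fun q => u (X q, Y q)) p =
    complex.Re (c (X p, Y p)) * 'D_v X p - complex.Im (c (X p, Y p)) * 'D_v Y p.
  move=> Up; have dp := du p Up; have dXp := dX p Up; have dYp := dY p Up.
  rewrite deriveE; last exact: (@ex_diff _ _ _ _ _ _ _ dp).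
  by rewrite (@diff_val _ _ _ _ _ _ _ dp) !deriveE.
have Dw v p : U p -> 'D_v (fun q => w (X q, Y q)) p =
    complex.Im (c (X p, Y p)) * 'D_v X p + complex.Re (c (X p, Y p)) * 'D_v Y p.
  move=> Up; have dp := dw p Up; have dXp := dX p Up; have dYp := dY p Up.
  rewrite deriveE; last exact: (@ex_diff _ _ _ _ _ _ _ dp).
  by rewrite (@diff_val _ _ _ _ _ _ _ dp) !deriveE.
have uE : (fun q => complex.Re ((G \o zeta) q)) = (fun q => u (X q, Y q)).
  by apply/funext => q; rewrite /u (_ : complex_of _ = zeta q) //; exact: plane_ofK.
have wE : (fun q => complex.Im ((G \o zeta) q)) = (fun q => w (X q, Y q)).
  by apply/funext => q; rewrite /w (_ : complex_of _ = zeta q) //; exact: plane_ofK.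
have cz p : U p -> (X q, Y q) @[q --> p] --> (X p, Y p).
  move=> Up; have c1 := differentiable_continuous (dX p Up).
  by have c2 := differentiable_continuous (dY p Up); exact: (cvg_pair c1 c2).
have nU p : U p -> nbhs p U by move=> Up; exact: open_nbhs_nbhs.
have cRe p : U p -> complex.Re (c (X q, Y q)) @[q --> p] -->
    complex.Re (c (X p, Y p)).
  by move=> Up; exact: cvg_comp (cz p Up) (cc p Up).1.
have cIm p : U p -> complex.Im (c (X q, Y q)) @[q --> p] -->
    complex.Im (c (X p, Y p)).
  by move=> Up; exact: cvg_comp (cz p Up) (cc p Up).2.
have cDX v p : U p -> 'D_v X q @[q --> p] --> 'D_v X p by exact: cX.
have cDY v p : U p -> 'D_v Y q @[q --> p] --> 'D_v Y p by exact: cY.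
split.
  split; rewrite ?uE ?wE; split=> [p Up|v p Up].
  - exact: (@ex_diff _ _ _ _ _ _ _ (du p Up)).
  - apply: (@near_eq_continuous _ _ (fun q => complex.Re (c (X q, Y q)) *
      'D_v X q - complex.Im (c (X q, Y q)) * 'D_v Y q)).
      by apply: filterS (nU p Up) => q /(Du v) ->.
    exact: (cvgB (cvgM (cRe p Up) (cDX v p Up)) (cvgM (cIm p Up) (cDY v p Up))).
  - exact: (@ex_diff _ _ _ _ _ _ _ (dw p Up)).
  - apply: (@near_eq_continuous _ _ (fun q => complex.Im (c (X q, Y q)) *
      'D_v X q + complex.Re (c (X q, Y q)) * 'D_v Y q)).
      by apply: filterS (nU p Up) => q /(Dw v) ->.
    exact: (cvgD (cvgM (cIm p Up) (cDX v p Up)) (cvgM (cRe p Up) (cDY v p Up))).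
move=> p Up; exists (c (X p, Y p)) => v.
rewrite /derive_complex uE wE Du // Dw // -/X -/Y.
have mulE (a b s t : R) :
    (a * s - b * t) +i* (b * s + a * t) = (a +i* b) * (s +i* t).
  by simpc; rewrite [b * s + _]addrC.
by rewrite mulE; case: (c _).
Qed.

(** That [df] is a complex multiple of [d zeta] is precisely the Cauchy-Riemann system in the
    coordinate [zeta]; [diff_factor_inverse] transports it through [Z]. *)
Lemma holomorphic_comp_inverse (f : R * R -> R[i]) (Z : R[i] -> R * R) :
  C1_complex U f ->
  (forall p, U p -> exists c, forall v,
    derive_complex v f p = c * derive_complex v zeta p) ->
  (forall p, U p -> Z (zeta p) = p) ->
  forall z, (zeta @` U) z -> derivable (f \o Z : R[i]^o -> R[i]^o) z 1.
Proof.
move=> [[df1 _] [df2 _]] fc ZK _ [p Up <-].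
have [[dX _] [dY _]] := Czeta; have [[a b] cE] := fc p Up.
apply: (@cauchy_riemann_derivable _ _ _ (a +i* b)).
pose Zp w := Z (complex_of w).
have ZpK q : U q -> Zp (X q, Y q) = q.
  by move=> Uq; rewrite /Zp -[RHS]ZK // -[zeta q]plane_ofK.
have near_inv : \forall w \near (X p, Y p), (X (Zp w), Y (Zp w)) = w.
  apply: filterS (zeta_local_surjection hU (@subset_refl _ U) Up) => w [q Uq <-].
  by rewrite ZpK.
have cZ : {for (X p, Y p), continuous Zp}.
  (* [zeta] maps the open set [U] intersected with the interior of [A] onto a neighbourhood of the
     image of [p], and [Zp] sends that image back into [A]. *)
  move=> A; rewrite ZpK // => Ap.
  have Wp : (U `&` A^°) p by split=> //; exact: Ap.
  have oW : open (U `&` A^°) by apply: openI => //; exact: open_interior.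
  have := zeta_local_surjection oW (@subIsetl _ _ _) Wp.
  apply: filterS => w [q [Uq Aq] <-].
  by rewrite /= ZpK //; exact: interior_subset Aq.
have dE v : 'D_v (fun q => complex.Re (f q)) p = a * 'D_v X p - b * 'D_v Y p /\
    'D_v (fun q => complex.Im (f q)) p = b * 'D_v X p + a * 'D_v Y p.
  have := cE v; rewrite /derive_complex -/X -/Y; simpc => -[-> ->].
  by split=> //; rewrite addrC.
have dXp := dX p Up; have dYp := dY p Up.
have d1 := df1 p Up; have d2 := df2 p Up.
split.
  apply: (@is_diff_eq _ _ _ _ (fun h => a * h.1 + - b * h.2)).
    apply: (diff_factor_inverse d1 dXp dYp (jac Up)) => // [h|].
      by rewrite -!deriveE // (dE h).1 mulNr.
    exact: ZpK.
  by apply/funext => h; rewrite mulNr.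
apply: (diff_factor_inverse d2 dXp dYp (jac Up)) => // [h|].
  by rewrite -!deriveE // (dE h).2.
exact: ZpK.
Qed.

End ChangeOfVariable.

(** * The ring isomorphism *)

Lemma subset_C1 (R : realType) (U W : set (R * R)) (u : R * R -> R) :
  W `<=` U -> C1 U u -> C1 W u.
Proof.
by move=> WU [du cu]; split=> [p /WU|v p /WU]; [exact: du|exact: cu].
Qed.

Theorem corollary1p2 (R : realType) (Omega Omega' : set (R * R))
    (alpha beta : R * R -> R)
    (openOmega : open Omega) (openOmega' : open Omega')
    (ell : elliptic_structure Omega alpha beta)
    (rig : rigid Omega alpha beta)
    (subOmega : Omega' `<=` Omega)
    (Phi_neq0 : forall p, Omega' p -> Phi (spectral alpha beta) p != 0)
    (xi_inj : set_inj Omega' (xi (spectral alpha beta))) :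
  let lam := spectral alpha beta in
  exists (openV : open (xi lam @` Omega' : set R[i]^o))
         (phi : {rmorphism holomorphic_ring openV ->
                           rigid_holomorphic_ring lam openOmega'}),
    bijective phi /\
    forall (g : holomorphic_ring openV) (p : Omega'),
      phi g p = g (image_val (xi lam) p).
Proof.
move=> lam.
have Ulam : C1_complex Omega' lam.
  have [C1 C2] := spectral_C1 openOmega ell.
  by split; [exact: subset_C1 subOmega C1|exact: subset_C1 subOmega C2].
have rigl p : Omega' p -> dx lam p + lam p * dy lam p = 0.
  by move=> /subOmega; exact: rig.
have Cxi := C1_xi openOmega' Ulam.
have jac p : Omega' p -> jacobian2 (fun q => complex.Re (xi lam q))
    (fun q => complex.Im (xi lam q)) p != 0.
  move=> Op; apply: (jacobian_xi openOmega' Ulam Op (rigl p Op)) (Phi_neq0 p Op).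
  by apply: Im_spectral_gt0 ell _ _; exact: subOmega.
have xi_rig p : Omega' p -> dx (xi lam) p + lam p * dy (xi lam) p = 0.
  by move=> Op; exact: (xi_rigid openOmega' Ulam (rigl p Op) Op).
have dy_xi0 p : Omega' p -> dy (xi lam) p != 0.
  move=> Op; have := Phi_neq0 p Op; rewrite (Phi_xi openOmega' Ulam Op (rigl p Op)).
  by rewrite mulf_eq0 negb_or conjc_eq0 => /andP[].
pose openV := open_image_zeta openOmega' Cxi jac xi_inj.
exists openV.
(* The equality may fail off [Omega'], where [xi] can still take values in the image; derivatives
   are therefore compared through equality near a point. *)
have compE (g : holomorphic_ring openV) (q : R * R) : Omega' q ->
    valL_ 0 (fun p : Omega' => g (image_val (xi lam) p)) q =
    valL_ 0 g (xi lam q).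
  move=> Oq; have Aq := mem_set Oq.
  have Axi : xi lam q \in xi lam @` Omega' by apply/mem_set; exists q.
  rewrite (valL0E _ Aq) (valL0E _ Axi); congr (g _); exact: val_inj.
have comp_rigid (g : holomorphic_ring openV) :
    (fun p : Omega' => g (image_val (xi lam) p)) \in
    rigid_holomorphic lam openOmega'.
  have /asboolP dg := holomorphic_valP g.
  have [Cg Dg] := holomorphic_comp_C1 openOmega' Cxi jac xi_inj dg.
  set h := fun p => _.
  have near_h p : Omega' p -> \forall q \near p, (valL_ 0 g \o xi lam) q = valL_ 0 h q.
    move=> Op; have : nbhs p Omega' by exact: open_nbhs_nbhs.
    by apply: filterS => q Oq; rewrite compE.
  apply/asboolP; split.
    split; [apply: (eq_C1 openOmega' _ Cg.1)|apply: (eq_C1 openOmega' _ Cg.2)];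
      by move=> p /(compE g) ->.
  move=> p Op; rewrite /dx /dy -!(derive_complex_near_eq _ (near_h p Op)).
  (* The common factor [c] comes out and leaves the rigidity equation of [xi]. *)
  have [c cE] := Dg p Op; rewrite !cE.
  rewrite mulrCA -mulrDr -/(dx (xi lam) p) -/(dy (xi lam) p) xi_rig //.
  exact: mulr0.
pose phi (g : holomorphic_ring openV) := RigidHolomorphic (comp_rigid g).
have phiB : zmod_morphism phi.
  by move=> g1 g2; apply: val_inj; apply/funext => p.
have phiM : monoid_morphism phi.
  by split=> [|g1 g2]; apply: val_inj; apply/funext => p.
pose phiR : {rmorphism holomorphic_ring openV ->
    rigid_holomorphic_ring lam openOmega'} :=
  HB.pack phi (GRing.isZmodMorphism.Build _ _ phi phiB)
    (GRing.isMonoidMorphism.Build _ _ phi phiM).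
exists phiR; split; last by [].
have phi_inj : injective phi.
  move=> g1 g2 E; apply: val_inj; apply/funext => z.
  have [q Oq xiq] := set_mem (valP z).
  pose p : Omega' := exist _ q (mem_set Oq).
  have -> : z = image_val (xi lam) p by apply: val_inj; rewrite /= -xiq.
  exact: (congr1 (fun h : rigid_holomorphic_ring lam openOmega' => rigid_val h p) E).
(* [Z] is the inverse of [xi] on the image, extended by the arbitrary value [0]. *)
have /choice[Z ZP] z : exists q, (xi lam @` Omega') z -> Omega' q /\ xi lam q = z.
  by have [[q]|nV] := pselect ((xi lam @` Omega') z); [exists q|exists 0].
have ZK p : Omega' p -> Z (xi lam p) = p.
  move=> Op; have [|OZ E] := ZP (xi lam p); first by exists p.
  exact: (xi_inj _ _ (mem_set OZ) (mem_set Op) E).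
have phi_surj (h : rigid_holomorphic_ring lam openOmega') : exists g, phi g = h.
  have /asboolP[Ch eh] := rigid_valP h; pose f := valL_ 0 (h : Omega' -> R[i]).
  have fc p : Omega' p -> exists c, forall v,
      derive_complex v f p = c * derive_complex v (xi lam) p.
    (* [f] and [xi] both have differentials proportional to [dy - lam dx], so the ratio of their
       derivatives in [y] is the factor. *)
    move=> Op; exists (dy f p / dy (xi lam) p) => v.
    rewrite (rigid_derive v Ch Op (eh p Op)) (rigid_derive v Cxi Op (xi_rig p Op)).
    by rewrite mulrA divfK // dy_xi0.
  have dfZ := holomorphic_comp_inverse openOmega' Cxi jac xi_inj Ch fc ZK.
  pose g0 (z : (xi lam @` Omega' : set R[i]^o)) := f (Z (val z)).
  have g0_hol : g0 \in holomorphic openV.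
    apply/asboolP => z Vz; apply: near_eq_derivable (dfZ z Vz).
    have : nbhs (z : R[i]^o) (xi lam @` Omega') by exact: open_nbhs_nbhs.
    by apply: filterS => w /mem_set Vw; rewrite (valL0E _ Vw).
  exists (Holomorphic g0_hol); apply: val_inj; apply/funext => p.
  rewrite /= /g0 /= ZK; last exact: set_mem (valP p).
  by rewrite /f (valL0E _ (valP p)); congr (h _); exact: val_inj.
have [psi psiK] := choice phi_surj.
by exists psi => // g; apply: phi_inj; rewrite psiK.
Qed.
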